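(* Let $G=(V,E)$ be a finite simple strongly connected weighted directed graph with edge weights $x_e$, $e\in E$ (regarded as variables). The polynomial $\Phi_G$ satisfies $$\Phi_G = \prod_{W} (\Psi_{V \setminus W})^{m(W)},$$ where the product ranges over all proper strongly connected subsets $W\subset V$ and $\Psi_{V\setminus W}$ is the sum of the weights of the spanning forests of $G$ rooted at $V\setminus W$.
   Context: Simple means no loops and no multiple edges. A spanning tree of $G$ is a directed spanning tree rooted at some vertex, with all edges directed towards the root (every non-root vertex has exactly one outgoing edge in the tree, the root has none). A spanning forest rooted at $U\subseteq V$ is a set of edges in which each vertex outside $U$ has exactly one outgoing edge, vertices of $U$ have none, and following outgoing edges from any vertex leads to a vertex of $U$. The weight $w(\cdot)$ of a tree or forest is the product of the weights of its edges (so $\Psi_V=1$). The spanning tree graph $\mathcal{G}=(\mathcal{V},\mathcal{E})$: $\mathcal{V}$ is the set of spanning trees of $G$; for $t_i,t_j\in\mathcal{V}$ with roots $i,j$, $(t_i,t_j)\in\mathcal{E}$ iff $t_j$ is obtained from $t_i$ by adding the edge $(i,j)$ and removing the outgoing edge from $j$; this edge of $\mathcal{G}$ has weight $x_{(i,j)}$. Let $\mathcal{L}$ be the Laplacian of $\mathcal{G}$: its entry at $(t,t')$, $t\ne t'$, is minus the weight of the edge $(t,t')$ if $(t,t')\in\mathcal{E}$ and $0$ otherwise, and its rows sum to $0$. For $t\in\mathcal{V}$ let $\mathcal{L}^{(t)}$ be $\mathcal{L}$ with the row and column of $t$ removed. $\Phi_G$ is the rational function in the edge weights defined by $\det\mathcal{L}^{(t)}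 = w(t)\,\Phi_G$ for $t\in\mathcal{V}$ (it does not depend on $t$); equivalently $\Phi_G=\tau(\mathcal{G})/\tau(G)$, where $\tau(\cdot)$ denotes the sum of the weights of all spanning trees (over all roots). It is in fact a polynomial. A subset $W\subseteq V$ is strongly connected if the subgraph of $G$ induced on $W$ is strongly connected (single vertices are strongly connected; the empty set may be included or omitted in the product since $\Psi_V=1$). Definition of $m(W)$ for non-empty strongly connected $W$: fix $w\in W$ and an ordering of the edges of $G$. For a spanning tree $t$ rooted at $w$, perform a modified breadth-first traversal of $G$ from $w$: vertices are processed first-in first-out starting with $w$; when processing a vertex $u$, examine the incoming edges $(v,u)$ in the fixed order; if $v$ has not been visited before (nor deleted), it is now first visited via $(v,u)$: if $(v,u)$ belongs to $t$ then $v$ is kept and put in the queue, and otherwise $v$ and all edges incident to it are deleted from the graph before continuing. When the algorithm terminates, $\psi(t)$ is the strongly connected component containing $w$ of the graph induced on the remaining (non-deleted) vertices. Then $m(W)=m(W,w)$ is the number of spanning trees $t$ rooted at $w$ with $\psi(t)=W$; this number does not depend on the choice of $w\in W$ or of the ordering. *)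

(* Defs.v *)
From HB Require Import structures.
From mathcomp Require Import all_boot all_order all_algebra.
From mathcomp Require Import mpoly.

Set Implicit Arguments.
Unset Strict Implicit.
Unset Printing Implicit Defensive.

Import GRing.Theory.
Local Open Scope ring_scope.

Notation "x %:F" := (@FracField.tofrac _ x) : ring_scope.

(* A simple directed graph on V is an irreflexive relation E : rel V, the pair
   (u, v) being an edge iff E u v.  Sets of edges have type {set V * V}. *)
Section Digraph.

Variables (V : finType) (E : rel V).
Implicit Types (F : {set V * V}) (U W : {set V}) (e : V * V) (s : seq (V * V)).

Definition edge : finType := {e : V * V | E e.1 e.2}.

(* One variable x_e for each e : edge. *)
Definition wring : idomainType := {mpoly int[#|edge|]}.

(* Extended by 0 to pairs that are not edges, so as to be total on V * V. *)
Definition xvar (e : V * V) : wring :=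
  if insub e is Some e' then 'X_(enum_rank (e' : edge)) else 0.

Definition weight F : wring := \prod_(e in F) xvar e.

Definition rel_of_edges F : rel V := fun u v => (u, v) \in F.

Definition outedges F u : {set V * V} := [set e in F | e.1 == u].

Definition spanning_forest U F : bool :=
  [&& [forall e in F, E e.1 e.2],
      [forall u, #|outedges F u| == (if u \in U then 0%N else 1%N)]
    & [forall u, exists r in U, connect (rel_of_edges F) u r]].

Definition Psi U : wring := \sum_(F | spanning_forest U F) weight F.

Definition spanning_tree_at (r : V) F : bool := spanning_forest [set r] F.

(* A spanning tree is stored with its root, which its edge set determines. *)
Definition sptree : finType :=
  {rF : V * {set V * V} | spanning_tree_at rF.1 rF.2}.

Definition troot (t : sptree) : V := (val t).1.
Definition tedges (t : sptree) : {set V * V} := (val t).2.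

Definition tree_edge (t t' : sptree) : bool :=
  E (troot t) (troot t') &&
  (tedges t' ==
     ((troot t, troot t') |: tedges t) :\: outedges (tedges t) (troot t')).

Definition tree_weight (t t' : sptree) : wring :=
  if tree_edge t t' then xvar (troot t, troot t') else 0.

Definition tree_laplacian : 'M[wring]_#|sptree| :=
  \matrix_(a, b)
    if a == b then \sum_(c | c != a) tree_weight (enum_val a) (enum_val c)
    else - tree_weight (enum_val a) (enum_val b).

Definition reduced_tree_laplacian (t : sptree) : 'M[wring]_(#|sptree|.-1) :=
  row' (enum_rank t) (col' (enum_rank t) tree_laplacian).

Definition is_Phi (Phi : {fraction wring}) : Prop :=
  forall t : sptree,
    (\det (reduced_tree_laplacian t))%:F = (weight (tedges t))%:F * Phi.

Definition induced W : rel V := fun u v => [&& u \in W, v \in W & E u v].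

(* The empty set is not strongly connected. *)
Definition strongly_connected W : bool :=
  (W != set0) && [forall u in W, forall v in W, connect (induced W) u v].

Definition edge_ordering s : Prop :=
  uniq s /\ forall e, (e \in s) = E e.1 e.2.

(* State of the traversal: queue, visited and kept vertices, deleted vertices. *)
Definition bfs_state : Type := (seq V * {set V} * {set V})%type.

Definition bfs_examine F u (st : bfs_state) e : bfs_state :=
  let: (q, vis, del) := st in
  if (e.2 == u) && (e.1 \notin vis :|: del) then
    if e \in F then (rcons q e.1, e.1 |: vis, del) else (q, vis, e.1 |: del)
  else st.

Definition bfs_step s F (st : bfs_state) : bfs_state :=
  let: (q, vis, del) := st in
  if q is u :: q' then foldl (bfs_examine F u) (q', vis, del) s else st.

(* Each vertex enters the queue at most once, so #|V| steps empty the queue. *)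
Definition bfs s (w : V) F : bfs_state :=
  iter #|V| (bfs_step s F) ([:: w], [set w], set0).

Definition remaining s w F : {set V} := ~: (bfs s w F).2.

Definition scc W w : {set V} :=
  [set v in W | connect (induced W) w v && connect (induced W) v w].

Definition psi s w F : {set V} := scc (remaining s w F) w.

(* The number m(W, w), computed with the ordering s of the edges. *)
Definition mult s W w : nat :=
  #|[set F | spanning_tree_at w F & psi s w F == W]|.

End Digraph.

(* Main.v *)
From HB Require Import structures.
Require Import Defs.
From mathcomp Require Import all_boot all_order all_fingroup all_algebra.
From mathcomp Require Import mpoly ring.

(** A spanning tree that makes a step of the tree graph moves its root along an
    edge of G, so the tree graph lifts the walk of the root.  More generally,
    any matrix H indexed by V, with nonzero entries only on the diagonal and at
    edges of G, lifts to a matrix indexed by the spanning trees ([lift_mx]).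
    The heart of the matter is the factorization ([char_poly_lift])

      char_poly (lift of H) = \prod_W char_poly (H restricted to W) ^+ m(W),

    W ranging over the strongly connected sets.  Both sides are monic, so in
    characteristic 0 it is enough that their roots have the same power sums
    ([power_sums_inj]); on the left these are the traces of the powers of the
    lift, that is, sums over closed walks of trees.

    A closed walk of the root from v, with set of visited vertices S, brings a
    tree back to itself exactly when the edges of the tree that leave S minus v
    are the last exits of the walk.  The edges that leave the other vertices
    are free: they form any spanning forest rooted at S, so the walk lifts to
    as many closed walks as there are such forests ([closed_walk_count]).  It
    contributes to the trace of the restriction of H to W exactly when S is
    contained in W.  Hence the two families of power sums agree as soon as

      \sum_(W contains S) m(W) = number of spanning forests rooted at S

    for every strongly connected S.  This is where the traversal enters: for w
    in S, the trees t rooted at w whose psi(t) contains S are those for which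
    no vertex of S gets deleted, so that each edge of t leaving S minus w is
    the edge by which the traversal discovers its source.  Removing these edges
    is a bijection onto the forests rooted at S ([traversal_count]).  The
    relation above determines m by induction from V downwards, so m depends
    neither on w nor on the ordering of the edges ([mult_indep]).

    For H = - Laplacian of G, the lift is - Laplacian of the tree graph.  The
    forest matrix-tree theorem ([det_laplacian_forests]) makes Psi (~: W) the
    value at 0 of the factor of W, and \sum_v Psi [set v] = tau(G) the
    derivative at 0 of the factor of V, which vanishes at 0 and has exponent 1.
    Taking derivatives at 0 shows that the principal minors of the Laplacian of
    the tree graph add up to tau(G) * Q, where Q is the announced product.
    Finally the row (w(t))_t is annihilated by that Laplacian
    ([tree_laplacian_null]), whose rows sum to 0, so that its principal minors
    are proportional to the w(t) ([null_vectors_cofactor]); as the sum of the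
    w(t) is tau(G), the minor at t is w(t) * Q. *)

Set Implicit Arguments.
Unset Strict Implicit.
Unset Printing Implicit Defensive.

Import GRing.Theory.
Local Open Scope ring_scope.

(** * Characteristic polynomials and traces of powers *)

Section CharPolyDerivative.
Variable R : comNzRingType.

Lemma deriv_prod (I : finType) (F : I -> {poly R}) :
  (\prod_i F i)^`() = \sum_i (F i)^`() * \prod_(k | i != k) F k.
Proof.
have derivB (r : seq I) : uniq r ->
    (\prod_(i <- r) F i)^`()
    = \sum_(i <- r) (F i)^`() * \prod_(k <- r | i != k) F k.
  elim: r => [|x r IH]; first by rewrite !big_nil derivC.
  case/andP=> xNr uniq_r; rewrite !big_cons derivM IH //= eqxx /=.
  have -> : \prod_(j <- r | x != j) F j = \prod_(j <- r) F j.
    rewrite -big_filter (all_filterP _) //; apply/allP => y y_r.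
    by apply: contraNneq xNr => ->.
  congr (_ + _); rewrite mulr_sumr !big_seq; apply: eq_bigr => i i_r.
  rewrite big_cons ifT; last by apply: contraNneq xNr => <-.
  by rewrite mulrCA.
by rewrite derivB ?index_enum_uniq.
Qed.

(** Jacobi's formula, in the case of X - A: only the diagonal entries have a
    nonzero derivative, so Leibniz's rule leaves the principal cofactors. *)
Lemma deriv_char_poly n (A : 'M[R]_n) :
  (char_poly A)^`() = \tr (\adj (char_poly_mx A)).
Proof.
rewrite /char_poly /determinant raddf_sum /mxtrace.
under [RHS]eq_bigr => i _ do rewrite mxE expand_cofactor.
rewrite (exchange_big_dep predT) //=; apply: eq_bigr => s _.
rewrite derivM.
have -> : ((-1) ^+ s : {poly R})^`() = 0.
  by case: (odd_perm s); rewrite ?expr1 ?expr0 ?derivN derivC ?oppr0.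
rewrite mul0r add0r deriv_prod mulr_sumr [RHS]big_mkcond; apply: eq_bigr => i _.
rewrite !mxE derivB derivC subr0 derivMn derivX eq_sym.
by case: eqVneq; rewrite ?mul1r ?mul0r ?mulr0.
Qed.

End CharPolyDerivative.

Section PowerSums.
Variable R : idomainType.
Implicit Types (p q : {poly R}) (s : nat -> R).

Lemma size_polyM_bound p q d :
  (size q <= d -> size (p * q)%R <= size p + d)%N.
Proof.
move=> sz_q; apply: leq_trans (size_polyMleq _ _) _.
by apply: leq_trans (leq_pred _) _; rewrite leq_add2l.
Qed.

(** If s k is the k-th power sum of the roots of p, then p' / p is the sum of
    the s k / X^(k+1).  The quotient of [reversed_sums s N] by X^N is the
    truncation of this series at order N, and [power_sums] expresses the
    expansion of p' / p without leaving polynomials: once the denominators are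
    cleared, the error has a degree that does not grow with N. *)
Definition reversed_sums s N : {poly R} :=
  \sum_(i < N) 'X^(N.-1 - i) * (s i)%:P.

Definition power_sums p s :=
  exists d, forall N, (size (p * reversed_sums s N - p^`() * 'X^N)%R <= d)%N.

Lemma eq_power_sums p s1 s2 : s1 =1 s2 -> power_sums p s1 -> power_sums p s2.
Proof.
move=> eq_s [d bound]; exists d => N; rewrite (leq_trans _ (bound N)) //.
by rewrite /reversed_sums; under eq_bigr do rewrite -eq_s.
Qed.

Lemma power_sums1 : power_sums 1 (fun=> 0).
Proof.
exists 0%N => N; rewrite derivC mul0r subr0 mul1r /reversed_sums.
by rewrite big1 ?size_poly0 // => i _; rewrite mulr0.
Qed.

Lemma power_sumsM p1 p2 s1 s2 : power_sums p1 s1 -> power_sums p2 s2 ->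
  power_sums (p1 * p2) (fun k => s1 k + s2 k).
Proof.
move=> [d1 bound1] [d2 bound2].
exists (maxn (size p2 + d1) (size p1 + d2)) => N.
have -> : reversed_sums (fun k => s1 k + s2 k) N
          = reversed_sums s1 N + reversed_sums s2 N.
  by rewrite -big_split; apply: eq_bigr => i _; rewrite polyCD mulrDr.
rewrite derivM; set r1 := reversed_sums _ N; set r2 := reversed_sums _ N.
have -> : p1 * p2 * (r1 + r2) - (p1^`() * p2 + p1 * p2^`()) * 'X^N
  = p2 * (p1 * r1 - p1^`() * 'X^N) + p1 * (p2 * r2 - p2^`() * 'X^N) by ring.
apply: leq_trans (size_polyD _ _) _; rewrite geq_max !leq_max.
by rewrite !size_polyM_bound ?bound1 ?bound2 ?orbT.
Qed.

Lemma power_sumsX p s m :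
  power_sums p s -> power_sums (p ^+ m) (fun k => s k *+ m).
Proof.
move=> p_s; elim: m => [|m IH]; first exact: power_sums1.
rewrite exprS; apply: eq_power_sums (power_sumsM p_s IH) => k.
by rewrite mulrS.
Qed.

Lemma power_sums_prod (I : finType) (P : pred I) (p : I -> {poly R})
    (s : I -> nat -> R) :
    (forall i, P i -> power_sums (p i) (s i)) ->
  power_sums (\prod_(i | P i) p i) (fun k => \sum_(i | P i) s i k).
Proof.
move=> p_s; elim: index_enum => [|i r IH].
  rewrite big_nil; apply: eq_power_sums power_sums1 => k.
  by rewrite big_nil.
rewrite big_cons; have [Pi | nPi] := boolP (P i); last first.
  by apply: eq_power_sums IH => k; rewrite big_cons (negPf nPi).
apply: eq_power_sums (power_sumsM (p_s i Pi) IH) => k.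
by rewrite big_cons Pi.
Qed.

(** Multiplying X^N - A^N = (X - A) * \sum_k X^(N-1-k) A^k by adj (X - A) and
    taking traces yields char_poly A times the reversed sum on one side, and on
    the other tr (adj (X - A)) X^N = (char_poly A)' X^N up to a remainder
    tr (adj (X - A) A^N), whose degree is at most that of adj (X - A). *)
Lemma char_poly_power_sums n (A : 'M[R]_n) :
  power_sums (char_poly A) (fun k => \tr (A ^+ k)).
Proof.
set B := char_poly_mx A; set C := map_mx polyC A.
exists (\max_i \max_j size (\adj B i j)%R) => N.
have C_exp k : C ^+ k = map_mx polyC (A ^+ k).
  elim: k => [|k IH]; first by rewrite !expr0 map_scalar_mx.
  by rewrite !exprS IH -!mulmxE map_mxM.
have X_exp k : ('X%:M : 'M[{poly R}]_n) ^+ k = ('X^k)%:M.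
  elim: k => [|k IH]; first by rewrite !expr0.
  by rewrite !exprS IH -mulmxE -scalar_mxM.
have -> : char_poly A * reversed_sums (fun k => \tr (A ^+ k)) N
  = \tr (\adj B *m (('X%:M) ^+ N - C ^+ N)).
  have comm_XC : GRing.comm ('X%:M) C by apply: comm_scalar_mx.
  rewrite (subrXX_comm N comm_XC) -mulmxE mulmxA mul_adj_mx.
  rewrite mul_scalar_mx mxtraceZ; congr (_ * _).
  rewrite raddf_sum; apply: eq_bigr => i _ /=.
  by rewrite X_exp C_exp mul_scalar_mx mxtraceZ trace_map_mx.
rewrite deriv_char_poly -/B mulmxBr linearB /= X_exp mul_mx_scalar mxtraceZ.
rewrite [X in (X - _ - _)]mulrC addrAC subrr sub0r size_polyN C_exp.
apply: leq_trans (size_sum _ _ _) _; apply/bigmax_leqP => i _.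
rewrite mxE; apply: leq_trans (size_sum _ _ _) _; apply/bigmax_leqP => j _.
rewrite [map_mx _ _ _ _]mxE mulrC mul_polyC.
apply: leq_trans (size_scale_leq _ _) _.
by rewrite (bigmax_sup i) // (bigmax_sup j).
Qed.

Lemma coefM_top p q m n : (size p <= m.+1)%N -> (size q <= n.+1)%N ->
  (p * q)`_(m + n) = p`_m * q`_n.
Proof.
move=> sz_p sz_q; have lt_m : (m < (m + n).+1)%N by rewrite ltnS leq_addr.
rewrite coefM (bigD1 (Ordinal lt_m)) //= addKn big1 ?addr0 // => i.
rewrite -val_eqE /= neq_ltn => /orP[lt_im | lt_mi].
  rewrite [q`__]nth_default ?mulr0 //; apply: leq_trans sz_q _.
  by rewrite ltn_subRL ltn_add2r.
by rewrite nth_default ?mul0r //; apply: leq_trans sz_p _.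
Qed.

(** Comparing leading coefficients, deg p = deg q holds in R; this is where
    characteristic 0 matters. *)
Lemma proportional_size p q : [pchar R] =i pred0 -> p != 0 -> q != 0 ->
  p^`() * q = p * q^`() -> size p = size q.
Proof.
move=> R0 p0 q0 pq.
have natr_inj m n : m%:R = n%:R :> R -> m = n.
  wlog le_mn : m n / (m <= n)%N => [W | ].
    by case/orP: (leq_total m n) => h e; [apply: W | apply/esym/W].
  move=> /eqP; rewrite eq_sym -subr_eq0 -natrB // => /eqP nm0.
  apply/eqP; rewrite eqn_leq le_mn -subn_eq0 /=.
  by move/pcharf0P: R0 => <-; apply/eqP.
have sp : (size p).-1.+1 = size p by rewrite prednK // size_poly_gt0.
have sq : (size q).-1.+1 = size q by rewrite prednK // size_poly_gt0.
(* Multiplying the derivatives by 'X restores their sizes, so that the degrees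
   can be read off even when p or q is constant. *)
suff /natr_inj eq_deg : (size p).-1%:R = (size q).-1%:R :> R.
  by rewrite -sp -sq eq_deg.
have /(congr1 (fun f : {poly R} => f`_((size p).-1 + (size q).-1))) e
  : 'X * p^`() * q = p * ('X * q^`()) by rewrite -mulrA pq mulrCA.
have lead (f : {poly R}) :
    ('X * f^`())`_(size f).-1 = lead_coef f *+ (size f).-1.
  by rewrite coefXM coef_deriv lead_coefE; case: (size f).-1.
have sz (f : {poly R}) : f != 0 -> (size ('X * f^`())%R <= (size f).-1.+1)%N.
  move=> f0; apply: leq_trans (size_polyMleq _ _) _.
  by rewrite size_polyX /= ltnS -ltnS prednK ?size_poly_gt0 ?lt_size_deriv.
have sz_lead (f : {poly R}) : f != 0 -> (size f <= (size f).-1.+1)%N.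
  by move=> f0; rewrite prednK // size_poly_gt0.
move: e; rewrite !coefM_top ?sz ?sz_lead // !lead -!lead_coefE.
rewrite mulrnAl mulrnAr -mulr_natl -[RHS]mulr_natl; apply: mulIf.
by rewrite mulf_neq0 ?lead_coef_eq0.
Qed.

(** The polynomials p and q have the same logarithmic derivative, because
    p' q - p q' times X^N has bounded degree as N grows.  Then p - q is also
    proportional to q in this sense, so it would have the degree of q if it
    were nonzero, while the leading terms of p and q cancel. *)
Lemma power_sums_inj p q s : [pchar R] =i pred0 ->
  p \is monic -> q \is monic -> power_sums p s -> power_sums q s -> p = q.
Proof.
move=> R0 mp mq [d1 bound1] [d2 bound2].
have p0 := monic_neq0 mp; have q0 := monic_neq0 mq.
have pq : p^`() * q = p * q^`().
  apply/eqP; rewrite -subr_eq0; apply: contraT => w0.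
  pose N := maxn (size q + d1) (size p + d2).
  have := size_mulXn N w0; set S := reversed_sums s N.
  have -> : (p^`() * q - p * q^`()) * 'X^N
    = p * (q * S - q^`() * 'X^N) - q * (p * S - p^`() * 'X^N) by ring.
  move=> sz_w; have : (N + size (p^`() * q - p * q^`())%R <= N)%N.
    rewrite -sz_w; apply: leq_trans (size_polyD _ _) _.
    rewrite size_polyN geq_max /N !leq_max.
    by rewrite !size_polyM_bound ?bound1 ?bound2 ?orbT.
  by rewrite -{2}[N]addn0 leq_add2l leqn0 size_poly_eq0 (negPf w0).
have eq_sz := proportional_size R0 p0 q0 pq.
apply/eqP; rewrite -subr_eq0; apply: contraT => D0.
have : size (p - q) = size q.
  apply: proportional_size => //.
  by rewrite derivB !mulrBl pq mulrC [q * _]mulrC.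
move=> eq_szD; suff : (size (p - q)%R < size q)%N by rewrite eq_szD ltnn.
move=> {eq_szD}.
have szD : (size (p - q)%R <= size q)%N.
  apply: leq_trans (size_polyD _ _) _.
  by rewrite size_polyN eq_sz maxnn.
have n0 : (0 < size q)%N by rewrite size_poly_gt0.
rewrite -(prednK n0) ltnS; apply/leq_sizeP => i.
rewrite leq_eqVlt => /orP[/eqP <- | lt_i]; last first.
  by rewrite nth_default // (leq_trans szD) // -(prednK n0).
by rewrite coefB -{1}eq_sz -!lead_coefE (monicP mp) (monicP mq) subrr.
Qed.

End PowerSums.

(** * Cofactors of a singular matrix *)

Section NullVectorCofactors.
Variables (R : comNzRingType) (n : nat) (A : 'M[R]_n).

(** Cramer's rule for the matrix B obtained from A by adding 1 to the entries
    of column t: on the left w sends B to the sum of its own entries in column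
    t, and the cofactors of B along column t are those of A. *)
Lemma left_null_cofactor (w : 'rV[R]_n) (s t : 'I_n) : w *m A = 0 ->
  w 0 s * \sum_r cofactor A r t = (\sum_r w 0 r) * cofactor A s t.
Proof.
move=> wA0; pose B := \matrix_(r, c) (A r c + (c == t)%:R).
have cofB r : cofactor B r t = cofactor A r t.
  rewrite /cofactor; congr (_ * \det _); apply/matrixP => i j.
  by rewrite !mxE [lift t j == t]eq_sym (negPf (neq_lift _ _)) addr0.
have wB : w *m B = (\sum_r w 0 r) *: delta_mx 0 t.
  apply/rowP => c; move/rowP/(_ c): wA0; rewrite !mxE eqxx /= => wA0.
  under eq_bigr => r _ do rewrite mxE mulrDr.
  by rewrite big_split /= wA0 add0r -mulr_suml.
have detB : \det B = \det A + \sum_r cofactor A r t.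
  rewrite (expand_det_col B t) (expand_det_col A t) -big_split /=.
  by apply: eq_bigr => r _; rewrite mxE eqxx cofB mulrDl mul1r.
have wdetA : w 0 s * \det A = 0.
  have := congr1 (fun M : 'rV_n => (M *m \adj A) 0 s) wA0.
  by rewrite -mulmxA mul_mx_adj mul_mx_scalar mul0mx !mxE mulrC.
have := congr1 (fun M : 'rV_n => (M *m \adj B) 0 s) wB.
rewrite -mulmxA mul_mx_adj mul_mx_scalar -scalemxAl -rowE !mxE cofB detB mulrC.
by rewrite mulrDr wdetA add0r.
Qed.

End NullVectorCofactors.

(** The cofactors are constant along the rows of A, by [left_null_cofactor]
    for the transpose of A, whose left kernel contains the row of ones. *)
Lemma null_vectors_cofactor (R : idomainType) n (A : 'M[R]_n) (w : 'rV[R]_n) t :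
    [pchar R] =i pred0 -> w *m A = 0 -> (forall s, \sum_c A s c = 0) ->
  w 0 t * \tr (\adj A) = (\sum_r w 0 r) * cofactor A t t.
Proof.
move=> R0 wA0 A1; rewrite -(left_null_cofactor t t wA0) /mxtrace.
congr (_ * _); apply: eq_bigr => s _; rewrite mxE.
have ones : const_mx 1 *m A^T = 0 :> 'rV_n.
  apply/rowP => c; rewrite !mxE -[RHS](A1 c).
  by apply: eq_bigr => j _; rewrite !mxE mul1r.
have cof c : n%:R * cofactor A s c = \sum_d cofactor A s d.
  have := left_null_cofactor c s ones; rewrite mxE mul1r cofactor_tr.
  under eq_bigr => r _ do rewrite cofactor_tr.
  under [in RHS]eq_bigr => r _ do rewrite mxE.
  by rewrite sumr_const card_ord => ->.
have n0 : n%:R != 0 :> R.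
  by move/pcharf0P: R0 => ->; rewrite -lt0n (leq_trans _ (ltn_ord t)).
by apply: (mulfI n0); rewrite !cof.
Qed.

(** * Rerooting forests along a walk *)

Section Forests.
Variables (V : finType) (E : rel V).
Implicit Types (F G : {set V * V}) (U S A : {set V}) (p : seq V).

Lemma forestP U F :
  reflect [/\ forall u v, (u, v) \in F -> E u v,
              forall u v, (u, v) \in F -> u \notin U,
              forall u v v', (u, v) \in F -> (u, v') \in F -> v = v'
            & forall u, exists2 r, r \in U & connect (rel_of_edges F) u r]
          (spanning_forest E U F).
Proof.
apply: (iffP and3P).
  case=> /forall_inP edges /forallP deg /forallP reach; split.
  - by move=> u v /edges.
  - move=> u v uv; apply/negP => uU; have := deg u; rewrite uU cards_eq0.
    by move/eqP/setP/(_ (u, v)); rewrite !inE uv eqxx.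
  - move=> u v v' uv uv'; have := deg u; case: ifP => _.
      by rewrite cards_eq0 => /eqP/setP/(_ (u, v)); rewrite !inE uv eqxx.
    case/cards1P => e /setP eE.
    have := eE (u, v); have := eE (u, v'); rewrite !inE uv uv' !eqxx /=.
    by move=> /esym/eqP<- /esym/eqP[].
  by move=> u; have /exists_inP := reach u.
case=> edges roots fct reach; split.
- by apply/forall_inP => -[u v] /edges.
- apply/forallP => u; case: ifPn => uU.
    rewrite cards_eq0; apply/eqP/setP => -[x y]; rewrite !inE /=.
    by apply/negP => /andP[xy /eqP xu]; case/negP: (roots _ _ xy); rewrite xu.
  have [r rU] := reach u; case/connectP => -[|v p] /=.
    by move=> _ ru; rewrite -ru rU in uU.
  case/andP=> uv _ _; apply/cards1P; exists (u, v); apply/setP => -[x y].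
  rewrite !inE /= xpair_eqE; apply/andP/andP => [[xy /eqP xu]|[/eqP-> /eqP->]].
    by rewrite xu in xy *; rewrite (fct _ _ _ xy uv).
  by [].
by apply/forallP => u; apply/exists_inP.
Qed.

(** Standing still is a step, since a lifted matrix may have diagonal terms. *)
Definition step : rel V := fun u v => (u == v) || E u v.

Definition reroot F i j :=
  if i == j then F else ((i, j) |: F) :\: outedges F j.

Lemma in_reroot F i j u v : (forall k, (i, k) \notin F) -> i != j ->
  ((u, v) \in reroot F i j)
  = if u == i then v == j else (u != j) && ((u, v) \in F).
Proof.
move=> iF ij; rewrite /reroot (negPf ij) !inE xpair_eqE /=.
case: (eqVneq u i) => [->|ui] /=; first by rewrite (negPf (iF v)) orbF.
by rewrite andbC; case: (_ \in F); rewrite ?andbF ?andbT.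
Qed.

(** The vertex j may or may not be a root of F.  A path to a root survives the
    loss of the edge leaving j up to its first visit to j, which is now a root;
    if it ended at i, it continues to j. *)
Lemma reroot_forest U F i j : i \in U -> step i j ->
  spanning_forest E U F -> spanning_forest E (j |: (U :\ i)) (reroot F i j).
Proof.
move=> iU; case/orP=> [/eqP<- | ij].
  by rewrite /reroot eqxx setD1K.
have [<-|neq_ij] := eqVneq i j; first by rewrite /reroot eqxx setD1K.
case/forestP => edges roots fct reach.
have iF k : (i, k) \notin F by apply/negP => /roots; rewrite iU.
apply/forestP; split.
- move=> u v; rewrite in_reroot //.
  by case: (eqVneq u i) => [-> /eqP-> | _ /andP[_ /edges]].
- move=> u v; rewrite in_reroot // !inE.
  case: (eqVneq u i) => [-> _ | _ /andP[uj /roots uU]].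
    by rewrite negb_or neq_ij.
  by rewrite negb_or uj.
- move=> u v v'; rewrite !in_reroot //.
  by case: (eqVneq u i) => [_ /eqP-> /eqP-> | _ /andP[_ /fct h] /andP[_ /h]].
move=> u; have [r rU /connectP[q]] := reach u.
elim: q u => [|v q IH] u /=.
  move=> _ <-; have [->|ri] := eqVneq r i.
    exists j; first by rewrite setU11.
    by apply: connect1; rewrite /rel_of_edges in_reroot // !eqxx.
  by exists r => //; rewrite !inE ri rU orbT.
case/andP=> uv vq r_q; have [->|uj] := eqVneq u j.
  by exists j; rewrite ?setU11.
have [r' r'U vr'] := IH v vq r_q; exists r' => //.
apply: connect_trans vr'; apply: connect1.
rewrite /rel_of_edges in_reroot // uj.
by case: eqVneq uv => // ->; rewrite /rel_of_edges (negPf (iF v)).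
Qed.

Fixpoint reroot_along F v p :=
  if p is j :: p' then reroot_along (reroot F v j) j p' else F.

Lemma reroot_along_forest U F v p : v \in U -> path step v p ->
    spanning_forest E U F ->
  spanning_forest E
    (last v p |: (U :\: [set x in v :: p])) (reroot_along F v p).
Proof.
elim: p U F v => [|j p IH] U F v vU /=.
  move=> _; rewrite (_ : _ |: _ = U) //; apply/setP => x; rewrite !inE.
  by case: eqVneq => [->|].
case/andP=> vj jp forestF.
have := IH _ _ _ (setU11 j (U :\ v)) jp (reroot_forest vU vj forestF).
rewrite (_ : _ |: _ :\: _ = last j p |: (U :\: [set x in [:: v, j & p]])) //.
apply/setP => x; rewrite !inE.
by case: (x == last j p); case: (x == j); case: (x == v); case: (x \in p).
Qed.

Definition agree_outside A F G :=
  forall e, e.1 \notin A -> (e \in F) = (e \in G).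

Lemma reroot_agree A F G i j : i \notin A -> agree_outside A F G ->
  agree_outside (A :\ j) (reroot F i j) (reroot G i j).
Proof.
move=> iA FG e; rewrite /reroot; have [<-|_] := eqVneq i j.
  rewrite !inE; have [ei _|_] := eqVneq e.1 i; last exact: FG.
  by rewrite FG // ei.
rewrite !inE; case: (eqVneq e.1 j) => [ej _|_]; last by move/FG->.
rewrite !andbT; have [eij|_] := eqVneq e (i, j); last by rewrite !andNb.
by rewrite FG // eij.
Qed.

(** Walking through a vertex overwrites the edges that leave it, so the final
    forest forgets the initial edges at all vertices of the walk. *)
Lemma reroot_along_agree A F G v p : v \notin A -> agree_outside A F G ->
  agree_outside (A :\: [set x in p]) (reroot_along F v p) (reroot_along G v p).
Proof.
elim: p A F G v => [|j p IH] A F G v vA FG /=.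
  by move=> e; rewrite !inE /=; apply: FG.
have jA : j \notin A :\ j by rewrite !inE eqxx.
move=> e eA; apply: (IH _ _ _ _ jA (reroot_agree vA FG)).
by move: eA; rewrite !inE negb_or; case: (e.1 == j); case: (e.1 \in p).
Qed.

Lemma reroot_along_outside F v p e :
  e.1 \notin v :: p -> (e \in reroot_along F v p) = (e \in F).
Proof.
elim: p F v => //= j p IH F v; rewrite inE negb_or => /andP[ev ejp].
rewrite IH // /reroot; case: eqVneq => // _; rewrite !inE.
move: ejp; rewrite inE negb_or => /andP[/negPf-> _]; rewrite andbF /=.
by case: eqVneq => // e_vj; rewrite e_vj eqxx in ev.
Qed.

Definition cut S F := [set e in F | e.1 \notin S].

Lemma cut_forest U S F : U \subset S ->
  spanning_forest E U F -> spanning_forest E S (cut S F).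
Proof.
move=> US /forestP[edges roots fct reach]; apply/forestP; split.
- by move=> u v; rewrite inE => /andP[/edges].
- by move=> u v; rewrite inE => /andP[].
- by move=> u v v'; rewrite !inE => /andP[/fct h _] /andP[/h].
move=> u; have [r rU /connectP[q]] := reach u.
elim: q u => [|v q IH] u /=.
  by move=> _ <-; exists r; rewrite ?(subsetP US).
case/andP=> uv vq r_q; have [uS|uS] := boolP (u \in S); first by exists u.
have [r' r'U vr'] := IH v vq r_q; exists r' => //.
by apply: connect_trans vr'; apply: connect1; apply/setIdP.
Qed.

Lemma cut_id S F : spanning_forest E S F -> cut S F = F.
Proof.
case/forestP=> _ roots _ _; apply/setP => -[u v]; rewrite inE /=.
by case uv: ((u, v) \in F) => //=; rewrite (roots _ _ uv).
Qed.

(** Rerooting a forest rooted at S along p adds the tree of last exits of p,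
    and cutting at S removes it.  A tree at v that p brings back to itself is
    recovered from its cut, because its edges leaving S do not affect where p
    takes it. *)
Lemma closed_walk_count v p : path step v p -> last v p = v ->
  #|[set F | spanning_tree_at E v F & reroot_along F v p == F]|
  = #|[set F | spanning_forest E [set x in v :: p] F]|.
Proof.
move=> vp last_p; set S := [set x in v :: p].
have vS : v \in S by rewrite !inE eqxx.
have outside F e : e.1 \notin S -> (e \in reroot_along F v p) = (e \in F).
  by rewrite inE; apply: reroot_along_outside.
have cutK F : spanning_forest E S F -> cut S (reroot_along F v p) = F.
  move=> forestF; rewrite -[RHS](cut_id forestF).
  apply/setP => e; rewrite [LHS]inE [RHS]inE.
  by have [_|eS] := boolP (e.1 \in S); rewrite ?andbF // outside.
have inj_reroot : {in [set F | spanning_forest E S F] &,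
    injective (fun F => reroot_along F v p)}.
  move=> F G; rewrite !inE => forestF forestG FG.
  by rewrite -(cutK F) // -(cutK G) // FG.
rewrite -(card_in_imset inj_reroot); apply: eq_card => F; rewrite inE.
have reroot_cut G : spanning_tree_at E v G ->
    reroot_along (cut S G) v p = reroot_along G v p.
  case/forestP=> _ rootG _ _; apply/setP => e.
  apply: (@reroot_along_agree (S :\ v)); rewrite ?inE ?eqxx //.
    case=> x y; rewrite !inE /=; case: (eqVneq x v) => [-> _|_ xS] /=.
      by case vy: (_ \in G) => //; have := rootG _ _ vy; rewrite inE eqxx.
    by rewrite xS andbT.
  by case: (e.1 == v); case: (e.1 \in p).
apply/idP/imsetP => [/andP[treeF /eqP fixF] | [G]].
  exists (cut S F); last by rewrite reroot_cut ?fixF.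
  by rewrite inE; apply: cut_forest treeF; rewrite sub1set.
rewrite inE => forestG ->.
have treeG : spanning_tree_at E v (reroot_along G v p).
  by have := reroot_along_forest vS vp forestG; rewrite last_p setDv setU0.
by rewrite treeG -{2}[G]cutK // reroot_cut /=.
Qed.

End Forests.

(** * The modified breadth-first traversal *)

Section Traversal.
Variables (V : finType) (E : rel V).
Implicit Types (F G : {set V * V}) (U S A : {set V}) (e : V * V).
Variables (s : seq (V * V)) (w : V).

(** The second component records the edges by which the kept vertices were
    discovered, from which the bijection of [traversal_count] rebuilds trees. *)
Definition trace_state : Type := (bfs_state V * {set V * V})%type.
Implicit Type st : trace_state.

Definition queue st := st.1.1.1.
Definition visited st := st.1.1.2.
Definition deleted st := st.1.2.
Definition kept st := st.2.

Definition examine F u st e : trace_state :=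
  (bfs_examine F u st.1 e,
   if [&& e.2 == u, e.1 \notin visited st :|: deleted st & e \in F]
   then e |: kept st else kept st).

Definition serve F st : trace_state :=
  if queue st is u :: q
  then foldl (examine F u) (q, visited st, deleted st, kept st) s else st.

Definition start : trace_state := ([:: w], [set w], set0, set0).

(** The set F is arbitrary: only its membership test guides the traversal, and
    the sets [lenient F] used below are not trees. *)
Definition traverse F k := iter k (serve F) start.

Lemma traverseS F k : traverse F k.+1 = serve F (traverse F k).
Proof. by []. Qed.

Lemma traverse_bfs F : (traverse F #|V|).1 = bfs s w F.
Proof.
rewrite /traverse /bfs; elim: #|V| => //= k <-.
case: (iter k _ _) => -[[[|u q] vis] del] par //=; rewrite /serve /=.
by elim: (s) (q, vis, del) par => //= e l IH st par; rewrite IH.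
Qed.

Variant examine_spec F u st e : trace_state -> Prop :=
| ExamineSkip of (e.2 != u) || (e.1 \in visited st :|: deleted st) :
    examine_spec F u st e st
| ExamineKeep of e.2 = u & e.1 \notin visited st & e.1 \notin deleted st
    & e \in F :
    examine_spec F u st e
      (rcons (queue st) e.1, e.1 |: visited st, deleted st, e |: kept st)
| ExamineDelete of e.2 = u & e.1 \notin visited st & e.1 \notin deleted st
    & e \notin F :
    examine_spec F u st e
      (queue st, visited st, e.1 |: deleted st, kept st).

Lemma examineP F u st e : examine_spec F u st e (examine F u st e).
Proof.
case: st => -[[q vis] del] par; rewrite /examine /bfs_examine /=.
rewrite /visited /deleted /=.
case: eqP => eu /=; last by constructor; move/eqP: eu => ->.
have [fresh|] /= := boolP (e.1 \notin _); last first.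
  by rewrite negbK => old; constructor; rewrite old orbT.
have := fresh; rewrite inE negb_or => /andP[vis_e del_e].
by have [eF|eF] := boolP (e \in F); constructor.
Qed.

Definition grows st st' :=
  [/\ {subset queue st <= queue st'},
      forall x, x \in visited st' -> (x \in visited st) || (x \in queue st'),
      visited st :|: deleted st \subset visited st' :|: deleted st',
      deleted st \subset deleted st' & kept st \subset kept st'].

Lemma foldl_grows F u st l : grows st (foldl (examine F u) st l).
Proof.
elim/last_ind: l => [|l e]; first by split=> // x ->.
rewrite foldl_rcons; set st' := foldl _ _ _ => -[qq vq vd dd pp].
case: examineP => [_|_ _ _ _|_ _ _ _] //; split=> //.
- by move=> x /qq qx; rewrite /queue /= mem_rcons inE qx orbT.
- move=> x; rewrite /queue /= !inE mem_rcons inE.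
  by case: eqVneq => [->|_] /=; [rewrite orbT | apply: vq].
- by apply: subset_trans vd _; rewrite -setUA subsetUr.
- by apply: subset_trans pp _; rewrite subsetUr.
- by apply: subset_trans vd _; rewrite setUCA subsetUr.
- by apply: subset_trans dd _; rewrite subsetUr.
Qed.

Lemma foldl_served F u st l e : e \in l -> e.2 = u ->
  e.1 \in visited (foldl (examine F u) st l)
          :|: deleted (foldl (examine F u) st l).
Proof.
elim: l st => //= e' l IH st.
rewrite inE => /orP[/eqP<-{e'} eu | el]; last first.
  exact: IH.
have [_ _ /subsetP sub _ _] :=
  foldl_grows F u (examine F u st e) l.
apply: sub; case: examineP => [|_ _ _ _|_ _ _ _].
- by rewrite eu eqxx.
- by rewrite !inE eqxx.
- by rewrite !inE eqxx orbT.
Qed.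

Lemma serve_grows F st :
  deleted st \subset deleted (serve F st) /\
  kept st \subset kept (serve F st).
Proof.
rewrite /serve; case: (queue st) => [|u q]; first by [].
by have [] := foldl_grows F u (q, visited st, deleted st, kept st) s.
Qed.

Lemma traverse_grows F k n : (k <= n)%N ->
  deleted (traverse F k) \subset deleted (traverse F n) /\
  kept (traverse F k) \subset kept (traverse F n).
Proof.
move/subnKC <-; elim: (n - k)%N => [|m [dm pm]]; first by rewrite addn0.
rewrite addnS traverseS; have [d p] := serve_grows F (traverse F (k + m)).
by split; [apply: subset_trans dm _ | apply: subset_trans pm _].
Qed.

(** The traversals make the same decisions: at the first disagreement over an
    edge, F would keep it or delete its source, and what is kept or deleted
    remains so. *)
Lemma traverse_eq F G n :
    (forall e, e \in F -> e \notin G -> e \notin kept (traverse F n)) ->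
    (forall e, e \notin F -> e \in G -> e.1 \notin deleted (traverse F n)) ->
  traverse F n = traverse G n.
Proof.
move=> keepP deleteP.
have foldl_eq u l st :
    deleted (foldl (examine F u) st l) \subset deleted (traverse F n) ->
    kept (foldl (examine F u) st l) \subset kept (traverse F n) ->
  foldl (examine F u) st l = foldl (examine G u) st l.
  elim: l st => //= e l IH st dsub psub; rewrite IH //; congr foldl.
  have [_ _ _ de pe] := foldl_grows F u (examine F u st e) l.
  have := subset_trans de dsub; have := subset_trans pe psub.
  rewrite /examine /bfs_examine.
  case: st {IH dsub psub de pe} => -[[q vis] del] par /=.
  rewrite /visited /deleted /kept /=; case: (e.2 == u) => //=.
  case: (e.1 \notin _) => //=.
  have [eF|eF] := boolP (e \in F); have [eG|eG] := boolP (e \in G) => //=.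
  - move=> /subsetP/(_ e); rewrite setU11 => /(_ isT) e_par.
    by case/negP: (keepP e eF eG).
  - move=> _ /subsetP/(_ e.1); rewrite setU11 => /(_ isT) e_del.
    by case/negP: (deleteP e eF eG).
suff H k : (k <= n)%N -> traverse F k = traverse G k by exact: H.
elim: k => // k IH lt_kn; have := traverse_grows F lt_kn.
rewrite (traverseS F k) (traverseS G k) -IH ?(ltnW lt_kn) // /serve.
by case: queue => // u q [d p]; apply: foldl_eq.
Qed.

(** Each of the k vertices served so far and each vertex of the queue has been
    visited exactly once, so a nonempty queue after #|V| rounds would make more
    than #|V| visited vertices. *)
Lemma traverse_queue F : queue (traverse F #|V|) = [::].
Proof.
have H k : queue (traverse F k) = [::] \/
  (k + size (queue (traverse F k)) = #|visited (traverse F k)|)%N.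
  elim: k => [|k IH]; first by right; rewrite add0n cards1.
  rewrite traverseS /serve.
  case: IH => [eq_q | ]; first by left; rewrite eq_q.
  case eq_q: (queue _) => [|u q]; first by left; rewrite ?eq_q.
  move=> cnt; right; move: cnt.
  move: (visited _) (deleted _) (kept _) => vis del par.
  rewrite /= addnS => cnt.
  elim/last_ind: (s) => [|l e IH]; first by rewrite addSn.
  rewrite foldl_rcons; case: examineP => // _ fresh _ _.
  by rewrite /queue /visited /= size_rcons cardsU1 fresh addnS IH.
case: (H #|V|) => // cnt; apply/nilP; rewrite /nilp -leqn0 -(leq_add2l #|V|).
by rewrite cnt addn0 max_card.
Qed.

(** By induction on the rounds, this holds at the visited vertices that have
    left the queue, and in the end the queue is empty. *)
Lemma traverse_complete F e : e \in s -> e.2 \in visited (traverse F #|V|) ->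
  e.1 \in visited (traverse F #|V|) :|: deleted (traverse F #|V|).
Proof.
suff H k : {in s, forall e, e.2 \in visited (traverse F k) ->
    e.2 \notin queue (traverse F k) ->
    e.1 \in visited (traverse F k) :|: deleted (traverse F k)}.
  by move=> es e2; apply: H => //; rewrite traverse_queue.
elim: k => [|k IH] {}e es.
  by rewrite /visited /queue /= !inE => ->.
rewrite traverseS /serve.
case eq_q: (queue _) => [|u q]; first by move=> *; apply: IH; rewrite // eq_q.
set st := (q, _, _, _); have [qq vq /subsetP vd _ _] := foldl_grows F u st s.
move=> e2 e2q; have [eu | eu] := eqVneq e.2 u; first exact: foldl_served.
apply: vd; apply: IH => //; last first.
  by rewrite eq_q inE (negPf eu); apply: contra e2q => /qq.
by case/orP: (vq _ e2) => // e2q'; rewrite e2q' in e2q.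
Qed.

(** In such a state the kept edges form a tree rooted at w on the visited
    vertices. *)
Definition exploration F st :=
  [/\ w \in visited st,
      {subset queue st <= visited st},
      forall v u, (v, u) \in kept st ->
        [/\ v \in visited st, v != w, (v, u) \in F & (v, u) \in s],
      forall v u u', (v, u) \in kept st -> (v, u') \in kept st -> u = u'
    & forall v, v \in visited st -> connect (rel_of_edges (kept st)) v w].

Lemma connect_sub_edges F G u v : F \subset G ->
  connect (rel_of_edges F) u v -> connect (rel_of_edges G) u v.
Proof.
move/subsetP=> FG; apply: connect_sub => x y xy; apply: connect1.
exact: FG.
Qed.

Lemma traverse_exploration F k : exploration F (traverse F k).
Proof.
elim: k => [|k IH].
  split; rewrite /visited /queue /kept //=; first exact: set11.
  - by move=> x; rewrite !inE.
  - by move=> v u; rewrite in_set0.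
  - by move=> v u u'; rewrite in_set0.
  - by move=> v /set1P->.
rewrite traverseS /serve.
case eq_q: (queue _) => [|u q]; first by [].
set st := (q, _, _, _).
suff: exploration F (foldl (examine F u) st s)
    /\ u \in visited (foldl (examine F u) st s) by case.
have: {subset s <= s} by [].
elim/last_ind: {1 3 4}(s) => [_|l e IHl sub_l].
  case: IH => w_vis sub_q sound fct reach; split.
    split; [exact: w_vis | | exact: sound | exact: fct | exact: reach].
    by move=> x xq; apply: sub_q; rewrite eq_q inE xq orbT.
  by apply: sub_q; rewrite eq_q mem_head.
case: IHl => [x xl | ]; first by apply: sub_l; rewrite mem_rcons inE xl orbT.
rewrite foldl_rcons; set st' := foldl _ _ _.
case=> -[w_vis sub_q sound fct reach] u_vis.
case: examineP => [_|eu fresh _ eF|_ _ _ _] //.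
have es : e \in s by apply: sub_l; rewrite mem_rcons mem_head.
case: e {sub_l} es eu fresh eF => v x /= es xu fresh eF.
rewrite {x}xu in es eF *.
have fresh_par x : (v, x) \notin kept st'.
  by apply: contra fresh => /sound[].
split; last by rewrite /visited /= setU1r.
split; rewrite /visited /queue /kept /=.
- by rewrite setU1r.
- by move=> x; rewrite mem_rcons !inE => /orP[->|/sub_q->]; rewrite ?orbT.
- move=> y z; rewrite !inE xpair_eqE.
  case/orP=> [/andP[/eqP-> /eqP->] | /sound[-> -> -> ->]].
    by rewrite eqxx; split=> //; apply: contraNneq fresh => ->.
  by rewrite orbT.
- move=> y z z'; rewrite !inE !xpair_eqE.
  have [->|_] := eqVneq y v; last exact: fct.
  by rewrite !(negPf (fresh_par _)) !orbF => /eqP-> /eqP->.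
have sub_par : kept st' \subset (v, u) |: kept st' by apply: subsetUr.
move=> y; rewrite !inE => /orP[/eqP-> | y_vis]; last first.
  exact: connect_sub_edges sub_par (reach _ y_vis).
apply: connect_trans (connect_sub_edges sub_par (reach _ u_vis)).
by apply: connect1; rewrite /rel_of_edges setU11.
Qed.

Lemma visited_parent F k v : v \in visited (traverse F k) -> v != w ->
  exists u, (v, u) \in kept (traverse F k).
Proof.
have [_ _ _ _ reach] := traverse_exploration F k.
move/reach/connectP=> [[|u p] /=]; first by move=> _ ->; rewrite eqxx.
by case/andP=> vu _ _ _; exists u.
Qed.
End Traversal.

(** * Counting the trees that spare a strongly connected set *)

Section TraversalCount.
Variables (V : finType) (E : rel V) (s : seq (V * V)) (w : V) (S : {set V}).
Hypotheses (s_ok : edge_ordering E s) (S_conn : strongly_connected E S).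
Hypothesis wS : w \in S.
Implicit Types (F G : {set V * V}).

Let run F := traverse s w F #|V|.

(** Since S is strongly connected and contains w, it lies in the component of
    w as soon as it survives. *)
Lemma sub_psi F : (S \subset psi E s w F) = [disjoint S & deleted (run F)].
Proof.
have remE : remaining s w F = ~: deleted (run F).
  by rewrite /remaining -traverse_bfs.
rewrite disjoints_subset -remE; apply/idP/idP => sub.
  by apply: subset_trans sub _; apply/subsetP => x; rewrite inE => /and3P[].
have [_ /forall_inP conn] := andP S_conn.
have connR x y : x \in S -> y \in S ->
    connect (induced E (remaining s w F)) x y.
  move=> xS yS; have /forall_inP/(_ y yS) := conn x xS.
  apply: connect_sub => a b /and3P[aS bS ab]; apply: connect1.
  by rewrite /induced !(subsetP sub).
by apply/subsetP => x xS; rewrite inE (subsetP sub) //= !connR.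
Qed.

Lemma root_out_free r F u : spanning_tree_at E r F -> (r, u) \notin F.
Proof.
by case/forestP=> _ roots _ _; apply/negP => /roots; rewrite inE eqxx.
Qed.

Lemma spared_visited F : [disjoint S & deleted (run F)] ->
  S \subset visited (run F).
Proof.
move=> spared; apply/subsetP => x xS.
have [_ /forall_inP/(_ x xS)/forall_inP/(_ w wS)] := andP S_conn.
case/connectP => p; elim: p x {xS} => [|y p IH] x /=.
  by move=> _ <-; have [] := traverse_exploration s w F #|V|.
case/andP=> /and3P[xS yS xy] py w_p; have y_vis := IH y py w_p.
have xy_s : (x, y) \in s by have [_ ->] := s_ok.
have := traverse_complete xy_s y_vis.
by rewrite inE (disjointFr spared xS) orbF.
Qed.

(** The traversal guided by [lenient F] keeps every vertex of S and decides as
    F elsewhere.  If F is a forest rooted at S, it is the traversal guided by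
    the tree that corresponds to F, before this tree is known. *)
Definition lenient F := F :|: [set e | e.1 \in S].

(** The edge added at each vertex of S other than w is the one by which the
    traversal discovers it. *)
Definition graft F := F :|: [set e in kept (run (lenient F)) | e.1 \in S].

Lemma run_lenient_cut F : [disjoint S & deleted (run F)] ->
  run (lenient (cut S F)) = run F.
Proof.
move=> spared; apply/esym/traverse_eq => -[x y].
  by move=> xyF; rewrite !inE xyF /=; case: (x \in S).
move=> xyF; rewrite !inE (negPf xyF) /= => xS.
by rewrite (disjointFr spared xS).
Qed.

(** At a vertex of S the edge of F is the one that discovers the vertex, since
    otherwise the vertex would be deleted. *)
Lemma graft_cut F : spanning_tree_at E w F ->
  [disjoint S & deleted (run F)] -> graft (cut S F) = F.
Proof.
move=> treeF spared; have [edges roots fct _] := forestP _ _ _ treeF.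
have [_ _ sound _ _] := traverse_exploration s w F #|V|.
apply/setP => -[x y]; rewrite /graft run_lenient_cut // !inE /=.
have [xS|xS] := boolP (x \in S); last by rewrite !andbF andbT orbF.
rewrite andbF andbT /=; apply/idP/idP => [/sound[] // | xyF].
have xw : x != w by have := roots _ _ xyF; rewrite inE.
have [z xz] := visited_parent (subsetP (spared_visited spared) x xS) xw.
by have [_ _ /(fct _ _ _ xyF) -> _] := sound _ _ xz.
Qed.

Lemma run_lenient_spared F : [disjoint S & deleted (run (lenient F))].
Proof.
rewrite disjoint_sym disjoints_subset /run; elim: #|V| => [|k IH].
  exact: sub0set.
rewrite traverseS /serve; case: queue => // u q.
set st := (q, _, _, _); have {IH} : deleted st \subset ~: S by [].
move: st => st sub_st; elim/last_ind: (s) => [|l e IHl] //; rewrite foldl_rcons.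
case: examineP => // _ _ _; rewrite !inE negb_or => /andP[_ eS].
by rewrite subUset sub1set inE eS.
Qed.

Lemma run_graft F : run (graft F) = run (lenient F).
Proof.
apply/esym/traverse_eq => e.
  by rewrite !inE negb_or; case: (e \in F) => //= ->; rewrite andbT.
by rewrite !inE negb_or => /andP[/negPf-> /negPf->]; rewrite andbF.
Qed.

Lemma cut_graft F : spanning_forest E S F -> cut S (graft F) = F.
Proof.
move=> forestF; rewrite -[RHS](cut_id forestF); apply/setP => e; rewrite !inE.
by case: (e.1 \in S); rewrite ?andbF ?orbF.
Qed.

(** Every vertex reaches S along F, and every vertex of S reaches w along the
    kept edges, which all belong to [graft F]. *)
Lemma graft_tree F : spanning_forest E S F -> spanning_tree_at E w (graft F).
Proof.
move=> forestF; have [edges roots fct reach] := forestP _ _ _ forestF.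
have spared := run_lenient_spared F.
have [_ _ sound fct_par reach_par] := traverse_exploration s w (lenient F) #|V|.
have par_graft : kept (run (lenient F)) \subset graft F.
  apply/subsetP => -[x y] xy; have [_ _] := sound _ _ xy.
  by rewrite !inE /= xy /=; case: (_ \in F).
apply/forestP; split.
- move=> x y; rewrite !inE => /orP[/edges // | /andP[/sound[_ _ _ xy_s] _]].
  by have [_ /(_ (x, y))] := s_ok; rewrite xy_s.
- move=> x y; rewrite !inE => /orP[/roots xS | /andP[/sound[_ xw _ _] _]] //.
  by apply: contraNneq xS => ->.
- move=> x y y'; rewrite !inE /=.
  case/orP=> [xyF | /andP[xy xS]] /orP[xyF' | /andP[xy' xS']].
  + exact: fct xyF xyF'.
  + by have := roots _ _ xyF; rewrite xS'.
  + by have := roots _ _ xyF'; rewrite xS.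
  + exact: fct_par xy xy'.
move=> x; exists w; first exact: set11.
have [r rS xr] := reach x.
apply: connect_trans (connect_sub_edges (subsetUl _ _) xr) _.
apply: connect_sub_edges par_graft (reach_par _ _).
exact: (subsetP (spared_visited spared)).
Qed.

Lemma traversal_count :
  #|[set F | spanning_tree_at E w F & S \subset psi E s w F]|
  = #|[set F | spanning_forest E S F]|.
Proof.
have inj_graft : {in [set F | spanning_forest E S F] &, injective graft}.
  move=> F G; rewrite !inE => forestF forestG FG.
  by rewrite -(cut_graft forestF) FG cut_graft.
rewrite -(card_in_imset inj_graft); apply: eq_card => F; rewrite inE sub_psi.
apply/andP/imsetP => [[treeF spared] | [G]].
  exists (cut S F); last by rewrite graft_cut.
  by rewrite inE; apply: cut_forest treeF; rewrite sub1set.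
rewrite inE => forestG ->.
by rewrite graft_tree ?run_graft ?run_lenient_spared.
Qed.

End TraversalCount.

(** * The multiplicities *)

Section Multiplicities.
Variables (V : finType) (E : rel V).
Implicit Types (F : {set V * V}) (S W : {set V}) (s : seq (V * V)).

Lemma scc_strongly_connected W w : scc E W w != set0 ->
  strongly_connected E (scc E W w).
Proof.
move=> W0; rewrite /strongly_connected W0 /=.
apply/forall_inP => u; rewrite inE => /and3P[_ wu uw].
apply/forall_inP => v; rewrite inE => /and3P[_ wv vw].
have /connectP[p] := connect_trans uw wv.
elim: p u wu {uw wv} => [|x p IH] u wu /=; first by move=> _ ->.
case/andP=> ux xp v_p.
have wx := connect_trans wu (connect1 ux).
apply: connect_trans (IH x wx xp v_p); apply: connect1.
have xw : connect (induced E W) x w.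
  by apply: connect_trans vw; apply/connectP; exists p.
have uw := connect_trans (connect1 ux) xw.
by case/and3P: ux => uW xW ux; rewrite /induced !inE uW xW wu uw wx xw.
Qed.

Definition nb_forests S := #|[set F | spanning_forest E S F]|.

Lemma sum_mult s w S : edge_ordering E s -> strongly_connected E S -> w \in S ->
  (\sum_(W | strongly_connected E W && (S \subset W)) mult E s W w)%N
    = nb_forests S.
Proof.
move=> s_ok S_conn wS; rewrite /nb_forests -(traversal_count s_ok S_conn wS).
rewrite -sum1_card (partition_big (psi E s w)
  (fun W => strongly_connected E W && (S \subset W))) /=; last first.
  move=> F; rewrite inE => /andP[_ sub]; rewrite sub andbT.
  apply: scc_strongly_connected; apply/set0Pn; exists w.
  exact: (subsetP sub).
apply: eq_bigr => W /andP[_ SW]; rewrite /mult -sum1_card; apply: eq_bigl => F.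
by rewrite !inE; case: eqVneq => [->|_]; rewrite ?SW ?andbT ?andbF.
Qed.

(** In [sum_mult] with S = W, the term of W is the number of forests rooted at
    W minus the multiplicities of the larger sets, which are known by
    induction. *)
Lemma mult_indep s1 s2 w1 w2 W : edge_ordering E s1 -> edge_ordering E s2 ->
    strongly_connected E W -> w1 \in W -> w2 \in W ->
  mult E s1 W w1 = mult E s2 W w2.
Proof.
move=> s1_ok s2_ok; have [n] := ubnP #|~: W|; elim: n W => // n IH W lt_n.
move=> W_conn w1W w2W.
have := sum_mult s1_ok W_conn w1W; rewrite -(sum_mult s2_ok W_conn w2W).
have PW : strongly_connected E W && (W \subset W) by rewrite W_conn subxx.
rewrite (bigD1 W) // [X in _ = X -> _](bigD1 W) //=.
set rest1 := (\sum_(_ | _) _)%N; set rest2 := (\sum_(_ | _) _)%N.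
suff -> : rest1 = rest2 by move/addIn.
apply: eq_bigr => W' /andP[/andP[W'_conn WW'] neq].
apply: IH; rewrite ?(subsetP WW') //; rewrite ltnS in lt_n.
apply: leq_trans lt_n; apply: proper_card; rewrite properEneq setCS WW' andbT.
by apply: contra neq => /eqP/setC_inj->.
Qed.

Lemma sum_mult_family (ord : {set V} -> seq (V * V)) (base : {set V} -> V) S :
    (forall W, strongly_connected E W -> edge_ordering E (ord W)) ->
    (forall W, strongly_connected E W -> base W \in W) ->
    strongly_connected E S ->
  (\sum_(W | strongly_connected E W && (S \subset W))
     mult E (ord W) W (base W))%N = nb_forests S.
Proof.
move=> ord_ok base_ok S_conn.
rewrite -(sum_mult (ord_ok S S_conn) S_conn (base_ok S S_conn)).
apply: eq_bigr => W /andP[W_conn SW].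
have baseS : base S \in W by apply: (subsetP SW); apply: base_ok.
by apply: mult_indep; rewrite ?baseS; auto.
Qed.

End Multiplicities.

(** * Lifting a matrix to the spanning trees *)

Section LiftedMatrix.
Variables (V : finType) (E : rel V) (R : comNzRingType) (H : V -> V -> R).
Implicit Types (t : sptree E) (p : seq V) (S W : {set V}).

Lemma sptreeP t : spanning_tree_at E (troot t) (tedges t).
Proof. exact: (valP t). Qed.

Lemma reroot_tree r F j : step E r j -> spanning_tree_at E r F ->
  spanning_tree_at E j (reroot F r j).
Proof.
by move=> rj /(reroot_forest (set11 r) rj); rewrite setDv setU0.
Qed.

(** Outside the steps from the root of t, where the default value is taken, the
    matrices to be lifted have zero entries. *)
Definition treroot t j : sptree E :=
  insubd t (j, reroot (tedges t) (troot t) j).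

Lemma val_treroot t j : step E (troot t) j ->
  val (treroot t j) = (j, reroot (tedges t) (troot t) j).
Proof.
move=> tj; rewrite val_insubd /= ifT //; exact: reroot_tree tj (sptreeP t).
Qed.

Lemma troot_treroot t j : step E (troot t) j -> troot (treroot t j) = j.
Proof. by move=> tj; rewrite {1}/troot val_treroot. Qed.

Lemma val_treroots t p : path (step E) (troot t) p ->
  val (foldl treroot t p)
  = (last (troot t) p, reroot_along (tedges t) (troot t) p).
Proof.
elim: p t => [|j p IH] t /=; first by rewrite [LHS]surjective_pairing.
case/andP=> tj jp; have root_j := troot_treroot tj.
by rewrite IH root_j // /tedges val_treroot.
Qed.

Definition lift_mx : 'M[R]_#|sptree E| :=
  \matrix_(a, b) \sum_j
    H (troot (enum_val a)) j *+ (treroot (enum_val a) j == enum_val b).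

Definition principal_mx W : 'M[R]_#|W| :=
  \matrix_(a, b) H (enum_val a) (enum_val b).

Fixpoint walks k : seq (seq V) :=
  if k is k'.+1 then [seq j :: p | j <- index_enum V, p <- walks k']
  else [:: [::]].

Lemma big_walksS k (f : seq V -> R) :
  \sum_(p <- walks k.+1) f p = \sum_j \sum_(p <- walks k) f (j :: p).
Proof. exact: big_allpairs_dep. Qed.

Fixpoint walk_weight u p : R :=
  if p is j :: p' then H u j * walk_weight j p' else 1.

Hypothesis H_supp : forall u v, ~~ step E u v -> H u v = 0.

Lemma walk_weight_supp u p : ~~ path (step E) u p -> walk_weight u p = 0.
Proof.
elim: p u => //= j p IH u; rewrite negb_and => /orP[/H_supp-> | /IH->].
  by rewrite mul0r.
by rewrite mulr0.
Qed.

Lemma sum_enum_val_eq (T : finType) (x : R) (t : T) (g : T -> R) :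
  \sum_(c < #|T|) x *+ (t == enum_val c) * g (enum_val c) = x * g t.
Proof.
rewrite -(big_enum_val (fun c => x *+ (t == c) * g c)) (bigD1 t) //= eqxx.
by rewrite big1 ?addr0 // => c /negPf; rewrite eq_sym => ->; rewrite mul0r.
Qed.

Lemma lift_exp k a b : (lift_mx ^+ k) a b = \sum_(p <- walks k)
  walk_weight (troot (enum_val a)) p
    *+ (foldl treroot (enum_val a) p == enum_val b).
Proof.
elim: k a b => [|k IH] a b.
  by rewrite expr0 mxE big_seq1 /= (inj_eq enum_val_inj).
rewrite exprS -mulmxE mxE big_walksS.
under eq_bigr => c _ do rewrite IH mxE mulr_suml.
rewrite exchange_big /=; apply: eq_bigr => j _.
rewrite (sum_enum_val_eq _ _ (fun t => \sum_(p <- walks k)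
  walk_weight (troot t) p *+ (foldl treroot t p == enum_val b))) mulr_sumr.
apply: eq_bigr => p _.
have [tj | /H_supp->] := boolP (step E (troot (enum_val a)) j).
  by rewrite troot_treroot // mulrnAr.
by rewrite !mul0r mul0rn.
Qed.

Lemma principal_exp W k a b : (principal_mx W ^+ k) a b = \sum_(p <- walks k)
  walk_weight (enum_val a) p
    *+ (all (mem W) p && (last (enum_val a) p == enum_val b)).
Proof.
elim: k a b => [|k IH] a b.
  by rewrite expr0 mxE big_seq1 /= (inj_eq enum_val_inj).
rewrite exprS -mulmxE mxE big_walksS.
under eq_bigr => c _ do rewrite IH mxE.
rewrite -(big_enum_val (fun c => H (enum_val a) c * \sum_(p <- walks k)
  walk_weight c p *+ (all (mem W) p && (last c p == enum_val b)))).
rewrite big_mkcond; apply: eq_bigr => j _ /=; case: (j \in W) => /=.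
  by rewrite mulr_sumr; apply: eq_bigr => p _; rewrite mulrnAr.
by rewrite big1.
Qed.

Lemma closed_walk_strongly_connected v p : path (step E) v p -> last v p = v ->
  strongly_connected E [set x in v :: p].
Proof.
move=> vp last_p; set S := [set x in v :: p].
have conn q u : u \in S -> {subset q <= S} -> path (step E) u q ->
    {in u :: q, forall x, connect (induced E S) u x
                       && connect (induced E S) x (last u q)}.
  elim: q u => [|y q IH] u uS qS /=.
    by move=> _ x; rewrite inE => /eqP->; rewrite connect0.
  case/andP=> uy yq.
  have yS : y \in S by apply: qS; rewrite mem_head.
  have {}uy : connect (induced E S) u y.
    case/orP: uy => [/eqP-> | uy]; first exact: connect0.
    by apply: connect1; rewrite /induced uS yS.
  have {}IH := IH y yS (fun z zq => qS z (mem_behead (s := y :: q) zq)) yq.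
  move=> x; rewrite inE => /orP[/eqP-> | /IH /andP[yx xl]].
    have /andP[_ yl] := IH y (mem_head y q).
    by rewrite connect0 (connect_trans uy yl).
  by rewrite xl (connect_trans uy yx).
have vS : v \in S by rewrite inE mem_head.
have subS : {subset p <= S} by move=> x xp; rewrite !inE xp orbT.
apply/andP; split; first by apply/set0Pn; exists v.
apply/forall_inP => x; rewrite inE => xp.
apply/forall_inP => y; rewrite inE => yp.
have /andP[_ xv] := conn p v vS subS vp x xp.
have /andP[vy _] := conn p v vS subS vp y yp.
by rewrite last_p in xv; apply: connect_trans xv vy.
Qed.

Lemma closed_lift_count v p : path (step E) v p ->
  #|[set t | troot t == v & foldl treroot t p == t]|
  = (nb_forests E [set x in v :: p] * (last v p == v))%N.
Proof.
move=> vp; have [last_p|last_p] := eqVneq (last v p) v; last first.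
  rewrite muln0; apply/eqP; rewrite cards_eq0.
  apply/eqP/setP => t; rewrite !inE.
  apply: contraNF last_p => /andP[/eqP tv /eqP fix_t].
  have := val_treroots (t := t) (p := p); rewrite tv fix_t => /(_ vp).
  by move/(congr1 fst); rewrite -/(troot t) tv => /esym/eqP.
rewrite muln1 /nb_forests -(closed_walk_count vp last_p).
have inj_edges : {in [set t | troot t == v & foldl treroot t p == t] &,
    injective (@tedges V E)}.
  move=> t t'; rewrite !inE => /andP[/eqP tv _] /andP[/eqP t'v _] eq_edges.
  apply: val_inj; rewrite [val t]surjective_pairing [val t']surjective_pairing.
  by congr pair; first exact: etrans tv (esym t'v).
rewrite -(card_in_imset inj_edges); apply: eq_card => F; rewrite inE.
apply/imsetP/andP => [[t] | [treeF /eqP fixF]].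
  rewrite inE => /andP[/eqP tv /eqP fix_t ->].
  have := val_treroots (t := t) (p := p); rewrite tv fix_t => /(_ vp).
  move/(congr1 snd); rewrite -/(tedges t) /= => <-.
  by rewrite -{1}tv; split; first exact: sptreeP.
exists (Sub (v, F) treeF : sptree E); last by rewrite /tedges SubK.
rewrite inE /troot SubK eqxx /= -val_eqE val_treroots /troot /tedges SubK //=.
by rewrite last_p fixF.
Qed.

(** Both sides are sums over the closed walks of H.  A walk with set of visited
    vertices S occurs in the left-hand side once for each forest rooted at S,
    and in the right-hand side M W times for each W that contains S; only
    strongly connected S occur. *)
Lemma lift_trace (M : {set V} -> nat) k :
    (forall S, strongly_connected E S ->
       (\sum_(W | strongly_connected E W && (S \subset W)) M W)%N
         = nb_forests E S) ->
  \tr (lift_mx ^+ k)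
  = \sum_(W | strongly_connected E W) \tr (principal_mx W ^+ k) *+ M W.
Proof.
move=> sumM.
have trW W : \tr (principal_mx W ^+ k) = \sum_v \sum_(p <- walks k)
    walk_weight v p *+ ([set x in v :: p] \subset W) *+ (last v p == v).
  rewrite /mxtrace; under eq_bigr => a _ do rewrite principal_exp.
  rewrite -(big_enum_val (fun v => \sum_(p <- walks k)
    walk_weight v p *+ (all (mem W) p && (last v p == v)))) big_mkcond.
  have subW v p : ([set x in v :: p] \subset W) = (v \in W) && all (mem W) p.
    apply/subsetP/andP => [sub | [vW /allP pW] x]; last first.
      by rewrite !inE => /orP[/eqP-> | /pW].
    split; first by rewrite sub // inE mem_head.
    by apply/allP => x xp; apply: sub; rewrite !inE xp orbT.
  apply: eq_bigr => v _; case: ifPn => vW; last first.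
    by rewrite big1 // => p _; rewrite subW (negPf vW) mul0rn.
  by apply: eq_bigr => p _; rewrite subW vW -mulrnA mulnb.
transitivity (\sum_v \sum_(p <- walks k) walk_weight v p
    *+ #|[set t | troot t == v & foldl treroot t p == t]|).
  rewrite /mxtrace; under eq_bigr => a _ do rewrite lift_exp.
  rewrite -(big_enum_val (fun t => \sum_(p <- walks k)
    walk_weight (troot t) p *+ (foldl treroot t p == t))) /=.
  rewrite (partition_big (@troot V E) predT) //=; apply: eq_bigr => v _.
  rewrite exchange_big; apply: eq_bigr => p _.
  rewrite -sum1_card -sumrMnr; under [in RHS]eq_bigl do rewrite inE.
  rewrite [RHS]big_mkcondr; apply: eq_bigr => t /eqP->.
  by case: (_ == t).
under [RHS]eq_bigr => W _ do rewrite trW -sumrMnl.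
rewrite [RHS]exchange_big; apply: eq_bigr => v _.
under [RHS]eq_bigr => W _ do rewrite -sumrMnl.
rewrite [RHS]exchange_big; apply: eq_bigr => p _.
have [vp | /walk_weight_supp->] := boolP (path (step E) v p); last first.
  by rewrite mul0rn big1 // => W _; rewrite !mul0rn.
rewrite closed_lift_count //; have [last_p|last_p] := eqVneq (last v p) v.
  rewrite muln1 -sumM ?closed_walk_strongly_connected //.
  rewrite -sumrMnr big_mkcondr; apply: eq_bigr => W _.
  by rewrite mulr1n; case: (_ \subset W); rewrite ?mul0rn.
by rewrite muln0 mulr0n big1 // => W _; rewrite mulr0n mul0rn.
Qed.

End LiftedMatrix.

(** By [lift_trace], both sides have the same power sums of roots. *)
Theorem char_poly_lift (V : finType) (E : rel V) (R : idomainType)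
    (H : V -> V -> R) (M : {set V} -> nat) :
    [pchar R] =i pred0 -> (forall u v, ~~ step E u v -> H u v = 0) ->
    (forall S, strongly_connected E S ->
       (\sum_(W | strongly_connected E W && (S \subset W)) M W)%N
         = nb_forests E S) ->
  char_poly (lift_mx E H)
  = \prod_(W | strongly_connected E W) char_poly (principal_mx H W) ^+ M W.
Proof.
move=> R0 H_supp sumM.
apply: (power_sums_inj R0 (char_poly_monic _) _ (char_poly_power_sums _)).
  by apply: monic_prod => W _; apply/monic_exp/char_poly_monic.
apply: (eq_power_sums (fun k => esym (lift_trace H_supp k sumM))).
by apply: power_sums_prod => W _; apply/power_sumsX/char_poly_power_sums.
Qed.

(** * The matrix-tree theorem for forests *)

Section MatrixTree.
Variables (V : finType) (E : rel V) (n : nat) (h : 'I_n -> V).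
Hypothesis h_inj : injective h.
Implicit Types (f : {ffun 'I_n -> V}) (F : {set V * V}).

Let U : {set V} := ~: [set h a | a : 'I_n].

(** A choice of one edge out of each vertex of the image of h. *)
Definition graph f := [set (h a, f a) | a : 'I_n].

Lemma in_graph f a v : ((h a, v) \in graph f) = (v == f a).
Proof.
by apply/imsetP/eqP => [[b _ [/h_inj-> ->]] | ->] //; exists a.
Qed.

Lemma graph_inj : injective graph.
Proof.
by move=> f g fg; apply/ffunP => a; apply/eqP; rewrite -in_graph -fg in_graph.
Qed.

Lemma weight_graph f : weight E (graph f) = \prod_a xvar E (h a, f a).
Proof. by rewrite /weight big_imset // => a b _ _ [/h_inj]. Qed.

Lemma notin_U u : u \notin U -> exists a, u = h a.
Proof. by rewrite inE negbK => /imsetP[a _ ->]; exists a. Qed.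

Lemma h_notin_U a : h a \notin U.
Proof. by rewrite inE negbK imset_f. Qed.

Lemma Psi_sum_graphs :
  Psi E U = \sum_(f | spanning_forest E U (graph f)) \prod_a xvar E (h a, f a).
Proof.
under [RHS]eq_bigr do rewrite -weight_graph.
pose D := [set f | spanning_forest E U (graph f)].
have -> : \sum_(f | spanning_forest E U (graph f)) weight E (graph f)
        = \sum_(f in D) weight E (graph f) by apply: eq_bigl => f; rewrite inE.
rewrite -(big_imset (weight E)) /=; last by move=> f g _ _ /graph_inj.
apply: eq_bigl => F; apply/idP/imsetP => [forestF | [f]]; last first.
  by rewrite inE => ? ->.
have [edges roots fct reach] := forestP _ _ _ forestF.
have out a : exists v, (h a, v) \in F.
  have [r rU /connectP[[|v p] /=]] := reach (h a).
    by move=> _ ra; rewrite ra (negPf (h_notin_U a)) in rU.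
  by case/andP=> av _ _; exists v.
pose f := [ffun a => xchoose (out a)].
suff F_graph : F = graph f by exists f; rewrite // inE -F_graph.
apply/setP => -[u v]; apply/idP/imsetP => [uv | [a _ [-> ->]]]; last first.
  by rewrite ffunE; apply: (xchooseP (out a)).
have [a ua] := notin_U (roots _ _ uv); exists a; rewrite // -ua ffunE.
by congr pair; apply: fct uv _; rewrite ua; apply: (xchooseP (out a)).
Qed.

(** The matrix that the choice f contributes to the expansion of the Laplacian
    minor by multilinearity in the rows. *)
Definition choice_mx f : 'M[wring E]_n :=
  \matrix_(a, b) ((a == b)%:R - (f a == h b)%:R).

(** A permutation with a nonzero term in Leibniz's formula follows f at the
    vertices that it moves, and these would then never reach a root. *)
Lemma det_choice_forest f :
  spanning_forest E U (graph f) -> \det (choice_mx f) = 1.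
Proof.
case/forestP=> _ _ _ reach.
have moved (s : {perm 'I_n}) a :
    (forall b, choice_mx f b (s b) != 0) -> s a = a.
  move=> nz; apply/eqP; apply: contraT; have [r rU /connectP[p]] := reach (h a).
  elim: p a => [|v p IH] a /=.
    by move=> _ ra; rewrite ra (negPf (h_notin_U a)) in rU.
  rewrite {1}/rel_of_edges in_graph => /andP[/eqP-> ap] r_p sa.
  have := nz a; rewrite mxE [a == s a]eq_sym (negPf sa) sub0r oppr_eq0.
  case: (f a =P h (s a)) => [fa _ | _]; last by rewrite eqxx.
  rewrite fa in ap r_p; apply: (IH (s a)) => //.
  by apply: contra sa => /eqP/perm_inj->.
rewrite /determinant (bigD1 1%g) //= odd_perm1 mul1r [X in _ + X]big1 ?addr0.
  apply: big1 => a _; rewrite perm1 mxE eqxx; case: eqP; last by rewrite subr0.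
  move=> fa; have [r rU /connectP[p]] := reach (h a).
  elim: p => [_ ra | v p IH /=].
    by rewrite ra (negPf (h_notin_U a)) in rU.
  by rewrite {1}/rel_of_edges in_graph fa => /andP[/eqP-> /IH].
move=> s s1; suff /existsP[a /eqP sa0] : [exists a, choice_mx f a (s a) == 0].
  by rewrite (bigD1 a) //= sa0 mul0r mulr0.
apply: contraR s1; rewrite negb_exists => /forallP nz.
by apply/eqP/permP => a; rewrite perm1; apply: moved.
Qed.

(** The indicator of the vertices that never reach a root is in the kernel. *)
Lemma det_choice_cyclic f : (forall a, E (h a) (f a)) ->
  ~~ spanning_forest E U (graph f) -> \det (choice_mx f) = 0.
Proof.
move=> edges nforest.
pose trapped a := ~~ [exists r in U, connect (rel_of_edges (graph f)) (h a) r].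
have [a0 trapped_a0] : exists a, trapped a.
  apply/existsP; apply: contraNT nforest; rewrite negb_exists => /forallP free.
  apply/forestP; split.
  - by move=> u v /imsetP[a _ [-> ->]].
  - by move=> u v /imsetP[a _ [-> _]]; apply: h_notin_U.
  - by move=> u v v' /imsetP[a _ [-> ->]]; rewrite in_graph => /eqP->.
  move=> u; have [uU | /notin_U[a ->]] := boolP (u \in U); first by exists u.
  by have := free a; rewrite negbK => /exists_inP.
pose x : 'cV[wring E]_n := \col_a (trapped a)%:R.
have Dx0 : choice_mx f *m x = 0.
  apply/colP => a; rewrite !mxE.
  under eq_bigr => b _ do rewrite !mxE mulrBl.
  rewrite big_split /= sumrN.
  rewrite (bigD1 a) //= eqxx mul1r big1 ?addr0; last first.
    by move=> b /negPf; rewrite eq_sym => ->; rewrite mul0r.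
  apply/eqP; rewrite subr_eq0; apply/eqP.
  have [fU | /notin_U[b fb]] := boolP (f a \in U).
    rewrite big1 => [|b _]; last first.
      case: eqP => [fb|]; rewrite ?mul0r //.
      by rewrite fb (negPf (h_notin_U b)) in fU.
    rewrite (_ : trapped a = false) //; apply/negbTE; rewrite negbK.
    apply/exists_inP; exists (f a) => //; apply: connect1.
    by rewrite /rel_of_edges in_graph.
  rewrite (bigD1 b) //= fb eqxx mul1r big1 ?addr0; last first.
    by move=> c /negPf; rewrite eq_sym (inj_eq h_inj) => ->; rewrite mul0r.
  congr (nat_of_bool _)%:R; congr (~~ _); apply: eq_existsb_in => r rU.
  apply/idP/idP => [/connectP[[|v p] /=] | br].
  - by move=> _ ra; rewrite ra (negPf (h_notin_U a)) in rU.
  - rewrite {1}/rel_of_edges in_graph fb => /andP[/eqP-> bp] r_p.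
    by apply/connectP; exists p.
  - apply: connect_trans br; apply: connect1.
    by rewrite /rel_of_edges in_graph fb.
have := congr1 (fun y : 'cV_n => (\adj (choice_mx f) *m y) a0 0) Dx0.
by rewrite mulmxA mul_adj_mx mul_scalar_mx mulmx0 !mxE trapped_a0 mulr1.
Qed.

Definition laplacian u v : wring E :=
  (\sum_k xvar E (u, k)) *+ (u == v) - xvar E (u, v).

(** Row a of the matrix is the sum, over the vertices k, of x_(h a, k) times
    the row with 1 at h a and -1 at k.  Expanding each row leaves a sum over
    the choices of one edge out of each h a, of which only the forests
    contribute. *)
Theorem det_laplacian_forests :
  \det (\matrix_(a, b) laplacian (h a) (h b)) = Psi E U.
Proof.
have lapE a b : laplacian (h a) (h b) =
    \sum_k xvar E (h a, k) * ((a == b)%:R - (k == h b)%:R).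
  under eq_bigr => k _ do rewrite mulrBr mulr_natr.
  rewrite big_split /= sumrN sumrMnl [X in _ = _ - X](bigD1 (h b)) //=.
  rewrite eqxx mulr1.
  rewrite [X in _ - (_ + X)]big1 => [|k /negPf->].
    by rewrite addr0 /laplacian (inj_eq h_inj).
  by rewrite mulr0.
transitivity (\sum_(f : {ffun 'I_n -> V})
    (\prod_a xvar E (h a, f a)) * \det (choice_mx f)).
  rewrite /determinant.
  under eq_bigr => s _.
    under eq_bigr => a _ do rewrite mxE lapE.
    rewrite bigA_distr_bigA /= mulr_sumr.
    under eq_bigr => f _ do rewrite big_split /= mulrCA.
  over.
  rewrite exchange_big; apply: eq_bigr => f _; rewrite mulr_sumr.
  apply: eq_bigr => s _; congr (_ * (_ * _)).
  by apply: eq_bigr => a _; rewrite mxE.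
rewrite Psi_sum_graphs [RHS]big_mkcond; apply: eq_bigr => f _.
case: ifPn => [/det_choice_forest-> | nforest]; first by rewrite mulr1.
have [/forallP edges | ] := boolP [forall a, E (h a) (f a)].
  by rewrite (det_choice_cyclic edges nforest) mulr0.
rewrite negb_forall => /existsP[a nE].
by rewrite (bigD1 a) //= /xvar insubN ?mul0r.
Qed.
End MatrixTree.

(** * The Laplacian of the tree graph *)

Section Stationary.
Variables (V : finType) (E : rel V).
Hypothesis E_irr : irreflexive E.
Implicit Types (F : {set V * V}) (t : sptree E).

Lemma xvar_edge u v : ~~ E u v -> xvar E (u, v) = 0.
Proof. by move=> nE; rewrite /xvar insubN. Qed.

Lemma weightU1 F e : e \notin F -> weight E (e |: F) = xvar E e * weight E F.
Proof. by move=> eF; rewrite /weight big_setU1. Qed.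

Lemma path_next F u p x : path (rel_of_edges F) u p -> x \in u :: p ->
  x != last u p -> exists2 y, y \in p & (x, y) \in F.
Proof.
elim: p u => [|v p IH] u /=; first by rewrite inE => _ ->.
case/andP=> uv vp; rewrite inE => /orP[/eqP-> _ | xp x_last].
  by exists v; rewrite ?mem_head.
by have [y yp xy] := IH v vp xp x_last; exists y; rewrite // inE yp orbT.
Qed.

(** Adding the edge from its root to j turns a tree into a graph with a single
    cycle, which passes through j; the root is the predecessor of j on the
    cycle.  In the proof j :: p is the cycle, starting at j: it is closed under
    following edges, hence contains i2, and since the walk returns to j right
    after i2, this must be its last vertex i1. *)
Lemma unicycle_root i1 i2 j F1 F2 : i1 != j ->
    spanning_tree_at E i1 F1 -> spanning_tree_at E i2 F2 ->
  (i1, j) |: F1 = (i2, j) |: F2 -> i1 = i2.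
Proof.
move=> i1j tree1 tree2 eqF; apply/eqP; apply: contraT => i12.
have [_ roots1 fct1 reach1] := forestP _ _ _ tree1.
have [_ _ _ reach2] := forestP _ _ _ tree2.
have i2_F1 : (i2, j) \in F1.
  have : (i2, j) \in (i1, j) |: F1 by rewrite eqF setU11.
  by rewrite in_setU1 xpair_eqE [i2 == i1]eq_sym (negPf i12).
have [_ /set1P-> /connectP[p0 p0_path p0_last]] := reach1 j.
case/shortenP: p0_path p0_last => p jp uniq_p _ p_last.
have closed_p x y : x \in j :: p -> (x, y) \in (i2, j) |: F2 -> y \in j :: p.
  move=> xp; rewrite -eqF !inE xpair_eqE => /orP[/andP[_ ->] // | xy].
  have x_last : x != last j p.
    by rewrite -p_last; apply: contraNneq (roots1 _ _ xy) => ->; rewrite set11.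
  have [z zp /(fct1 _ _ _ xy)->] := path_next jp xp x_last.
  by rewrite zp orbT.
have i2p : i2 \in j :: p.
  have along q x : x \in j :: p -> path (rel_of_edges F2) x q ->
      last x q \in j :: p.
    elim: q x => //= y q IH x xp /andP[xy]; apply: IH.
    by apply: closed_p xp _; rewrite setU1r.
  have [_ /set1P-> /connectP[q jq ->]] := reach2 j.
  by apply: along; rewrite ?mem_head.
have i2_last : i2 != last j p by rewrite -p_last eq_sym.
have [z zp /(fct1 _ _ _ i2_F1) jz] := path_next jp i2p i2_last.
by move: uniq_p; rewrite /= jz zp.
Qed.

(** The target of the edge leaving j in t; the default value occurs only when j
    is the root. *)
Definition parent t j : V := odflt j [pick k | (j, k) \in tedges t].

(** The last equation describes the same graph with a single cycle from the two
    trees at the ends of an edge of the tree graph. *)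
Lemma treroot_parent t j : E (troot t) j ->
  [/\ (j, parent t j) \in tedges t, (j, parent t j) \notin tedges (treroot t j),
      (troot t, j) \notin tedges t
    & (j, parent t j) |: tedges (treroot t j) = (troot t, j) |: tedges t].
Proof.
move=> tj; have tree_t := sptreeP t.
have [_ roots fct reach] := forestP _ _ _ tree_t.
have neq_tj : troot t != j by apply: contraTneq tj => ->; rewrite E_irr.
have jk : (j, parent t j) \in tedges t.
  rewrite /parent; case: pickP => //= none.
  have [_ /set1P-> /connectP[[|k p] /=]] := reach j.
    by move=> _ tj'; rewrite tj' eqxx in neq_tj.
  by case/andP=> jk _ _; case/negP: (negbT (none k)).
have root_out k : (troot t, k) \notin tedges t by apply: root_out_free tree_t.
have edges_reroot : tedges (treroot t j) = reroot (tedges t) (troot t) j.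
  by rewrite {1}/tedges val_treroot // /step tj orbT.
rewrite edges_reroot; split=> //.
  by rewrite in_reroot // [j == _]eq_sym (negPf neq_tj) eqxx.
apply/setP => -[x y]; rewrite !inE !xpair_eqE in_reroot //.
have [->|xt] := eqVneq x (troot t).
  by rewrite (negPf neq_tj) (negPf (root_out y)) orbF.
have [-> | xj] //= := eqVneq x j.
by rewrite orbF; apply/eqP/idP => [-> // | /(fct _ _ _ jk)].
Qed.

Lemma treroot_parent_inj t1 t2 j1 j2 : E (troot t1) j1 -> E (troot t2) j2 ->
    treroot t1 j1 = treroot t2 j2 -> parent t1 j1 = parent t2 j2 ->
  (t1, j1) = (t2, j2).
Proof.
move=> e1 e2 eq_t eq_k.
have rootE t j : E (troot t) j -> troot (treroot t j) = j.
  by move=> tj; rewrite troot_treroot // /step tj orbT.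
have eq_j : j1 = j2 by rewrite -(rootE _ _ e1) -(rootE _ _ e2) eq_t.
rewrite -{j2}eq_j in e2 eq_t eq_k *.
have [_ _ root1 unicycle1] := treroot_parent e1.
have [_ _ root2 unicycle2] := treroot_parent e2.
have eqF : (troot t1, j1) |: tedges t1 = (troot t2, j1) |: tedges t2.
  by rewrite -unicycle1 -unicycle2 eq_t eq_k.
have neq_j : troot t1 != j1 by apply: contraTneq e1 => ->; rewrite E_irr.
have eq_r := unicycle_root neq_j (sptreeP t1) (sptreeP t2) eqF.
congr pair; apply: val_inj.
rewrite [val t1]surjective_pairing [val t2]surjective_pairing.
congr pair; first exact: eq_r.
by rewrite -/(tedges t1) -/(tedges t2) -(setU1K root1) -(setU1K root2) eqF eq_r.
Qed.

(** The map from (t, j) to (treroot t j, parent t j) permutes the pairs of a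
    tree and an edge leaving its root, and preserves the product of their
    weights, which is the weight of the tree with this edge added.  Being
    injective on a finite set, it is onto. *)
Lemma weight_stationary t' :
  \sum_t \sum_j
    (weight E (tedges t) * xvar E (troot t, j)) *+ (treroot t j == t')
  = weight E (tedges t') * \sum_k xvar E (troot t', k).
Proof.
pose w (q : sptree E * V) := weight E (tedges q.1) * xvar E (troot q.1, q.2).
pose D := [set q : sptree E * V | E (troot q.1) q.2].
pose phi (q : sptree E * V) := (treroot q.1 q.2, parent q.1 q.2).
have w_notin q : q \notin D -> w q = 0.
  by rewrite inE => /xvar_edge xq; rewrite /w xq mulr0.
have phi_inj : {in D &, injective phi}.
  move=> [t1 j1] [t2 j2]; rewrite !inE /= => e1 e2 [].
  exact: treroot_parent_inj.
have phi_w : {in D, forall q, w (phi q) = w q}.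
  case=> t j; rewrite inE /= => tj.
  have [_ new old unicycle] := treroot_parent tj.
  rewrite /w /= troot_treroot; last by rewrite /step tj orbT.
  by rewrite mulrC -weightU1 // unicycle weightU1 // mulrC.
have phi_D : phi @: D = D.
  apply/eqP; rewrite eqEcard card_in_imset // leqnn andbT.
  apply/subsetP => _ /imsetP[[t j] + ->]; rewrite inE /= => tj.
  rewrite inE /= troot_treroot; last by rewrite /step tj orbT.
  have [jk _ _ _] := treroot_parent tj.
  by have [edges _ _ _] := forestP _ _ _ (sptreeP t); apply: edges jk.
have sum_D (P : pred (sptree E * V)) :
    \sum_t \sum_j w (t, j) *+ P (t, j) = \sum_(q in D) w q *+ P q.
  rewrite pair_big [RHS]big_mkcond; apply: eq_bigr => -[t j] _ /=.
  by case: ifPn => // /w_notin->; rewrite mul0rn.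
rewrite (sum_D (fun q => treroot q.1 q.2 == t')).
transitivity (\sum_(q in D) w (phi q) *+ ((phi q).1 == t')).
  by apply: eq_bigr => q qD; rewrite phi_w.
rewrite -(big_imset (fun q => w q *+ (q.1 == t')) phi_inj) /= phi_D.
rewrite -(sum_D (fun q => q.1 == t')) (bigD1 t') //= [X in _ + X]big1.
  by rewrite addr0 mulr_sumr; apply: eq_bigr => k _; rewrite eqxx.
by move=> t /negPf neq; rewrite big1 // => j _; rewrite neq.
Qed.

Lemma tree_weightE t t' :
  tree_weight t t' = \sum_j xvar E (troot t, j) *+ (treroot t j == t').
Proof.
rewrite (bigD1 (troot t')) //= big1 ?addr0 => [|j neq]; last first.
  have [tj | /xvar_edge->] := boolP (E (troot t) j); last by rewrite mul0rn.
  case: eqP => // e; rewrite -e troot_treroot ?eqxx // in neq.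
  by rewrite /step tj orbT.
rewrite /tree_weight /tree_edge.
have [tt' | /xvar_edge->] := boolP (E (troot t) (troot t')); last first.
  by rewrite mul0rn.
have neq : troot t != troot t' by apply: contraTneq tt' => ->; rewrite E_irr.
have -> : (treroot t (troot t') == t') = (tedges t' ==
    ((troot t, troot t') |: tedges t) :\: outedges (tedges t) (troot t')).
  rewrite -val_eqE val_treroot; last by rewrite /step tt' orbT.
  rewrite [val t']surjective_pairing xpair_eqE eqxx.
  by rewrite /reroot (negPf neq) eq_sym.
by rewrite /=; case: (_ == _).
Qed.

Lemma sum_tree_weight t :
  \sum_t' tree_weight t t' = \sum_k xvar E (troot t, k).
Proof.
under eq_bigr do rewrite tree_weightE.
rewrite exchange_big; apply: eq_bigr => j _.
rewrite (bigD1 (treroot t j)) //= eqxx big1 ?addr0 // => t' /negPf.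
by rewrite eq_sym => ->.
Qed.

Lemma tree_weight_diag t : tree_weight t t = 0.
Proof. by rewrite /tree_weight /tree_edge E_irr. Qed.

Lemma tree_laplacianE a b : tree_laplacian E a b =
  (\sum_k xvar E (troot (enum_val a), k)) *+ (a == b)
  - tree_weight (enum_val a) (enum_val b).
Proof.
rewrite mxE; have [<-|_] := eqVneq a b; last by rewrite sub0r.
rewrite tree_weight_diag subr0 -sum_tree_weight mulr1n.
rewrite [RHS](big_enum_val (tree_weight (enum_val a))) [RHS](bigD1 a) //=.
by rewrite tree_weight_diag add0r.
Qed.

Lemma tree_laplacian_row a : \sum_b tree_laplacian E a b = 0.
Proof.
under eq_bigr do rewrite tree_laplacianE.
rewrite big_split /= sumrN -(big_enum_val (tree_weight (enum_val a))) /=.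
rewrite sum_tree_weight (bigD1 a) //= eqxx [X in _ + X - _]big1 => [|b /negPf].
  by rewrite addr0 subrr.
by rewrite eq_sym => ->.
Qed.

Definition tree_weights : 'rV[wring E]_#|sptree E| :=
  \row_a weight E (tedges (enum_val a)).

(** The coordinate of a tree t' expresses the balance of [weight_stationary]
    between the edges of the tree graph that enter and leave t'. *)
Lemma tree_laplacian_null : tree_weights *m tree_laplacian E = 0.
Proof.
apply/rowP => b; rewrite !mxE.
under eq_bigr do rewrite mxE tree_laplacianE mulrBr.
rewrite big_split /= sumrN (bigD1 b) //= eqxx [X in _ + X - _]big1; last first.
  by move=> a /negPf->; rewrite mulr0.
rewrite addr0 -(big_enum_val
  (fun t => weight E (tedges t) * tree_weight t (enum_val b))) /=.
apply/eqP; rewrite subr_eq0 -weight_stationary; apply/eqP/eq_bigr => t _.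
by rewrite tree_weightE mulr_sumr; apply: eq_bigr => j _; rewrite mulrnAr.
Qed.

Lemma treroot_root t : treroot t (troot t) = t.
Proof.
apply: val_inj; rewrite val_treroot /step ?eqxx // /reroot eqxx.
by rewrite [RHS]surjective_pairing.
Qed.

Lemma tree_laplacian_lift :
  tree_laplacian E = - lift_mx E (fun u v => - laplacian E u v).
Proof.
apply/matrixP => a b; rewrite tree_laplacianE !mxE -sumrN tree_weightE.
under [RHS]eq_bigr => j _ do rewrite mulNrn opprK mulrnBl.
rewrite big_split /= sumrN; congr (_ - _).
rewrite [RHS](bigD1 (troot (enum_val a))) //= eqxx.
rewrite [X in _ = _ + X]big1 => [|j /negPf].
  by rewrite addr0 mulr1n treroot_root (inj_eq enum_val_inj).
by rewrite eq_sym => ->; rewrite mulr0n mul0rn.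
Qed.

Lemma generator_supp u v : ~~ step E u v -> - laplacian E u v = 0.
Proof.
rewrite negb_or /laplacian => /andP[/negPf-> /xvar_edge->].
by rewrite mulr0n subr0 oppr0.
Qed.

End Stationary.

(** * Specialization to the Laplacian *)

Section Assembly.
Variables (V : finType) (E : rel V).
Implicit Types (F : {set V * V}) (U W : {set V}).

(** Evaluating all variables at 1 shows that sums of weights do not vanish. *)
Definition eval1 : wring E -> int := meval (fun=> 1).
HB.instance Definition _ := GRing.RMorphism.on eval1.

Lemma pchar_wring : [pchar wring E] =i pred0.
Proof.
apply/pcharf0P => n; apply/eqP/eqP => [/(congr1 eval1) | -> //].
by rewrite rmorph_nat rmorph0 => /eqP; rewrite Num.Theory.pnatr_eq0 => /eqP.
Qed.

Lemma eval1_weight U F : spanning_forest E U F -> eval1 (weight E F) = 1.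
Proof.
case/forestP=> edges _ _ _; rewrite rmorph_prod big1 // => -[u v] /edges uv.
by rewrite /xvar insubT /= /eval1 mevalXU.
Qed.

Lemma Psi_set0 (v : V) : Psi E set0 = 0.
Proof.
apply: big_pred0 => F; apply/negP => /forestP[_ _ _ /(_ v)[r]].
by rewrite inE.
Qed.

Lemma nb_forestsT : nb_forests E [set: V] = 1%N.
Proof.
apply/eqP/cards1P; exists set0; apply/setP => F; rewrite !inE.
apply/idP/eqP => [/forestP[_ roots _ _] | ->].
  apply/setP => -[u v]; rewrite inE; apply/negP => /roots.
  by rewrite inE.
apply/forestP; split=> [u v|u v|u v v'|u]; rewrite ?inE //.
by exists u; rewrite ?inE.
Qed.

Lemma sum_tree_weights :
  \sum_(t : sptree E) weight E (tedges t) = \sum_v Psi E [set v].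
Proof.
rewrite pair_big_dep.
transitivity (\sum_(rF in [set val t | t : sptree E]) weight E rF.2).
  by rewrite big_imset //= => t t' _ _ /val_inj.
apply: eq_bigl => -[r F]; apply/imsetP/idP => [[t _ rF] | treeF].
  by have := valP t; rewrite -rF.
by exists (Sub (r, F) treeF : sptree E); rewrite ?SubK.
Qed.

Lemma char_poly_at0 n (A : 'M[wring E]_n) : (char_poly A).[0] = \det (- A).
Proof. by rewrite horner_coef0 char_poly_det -[- A]scaleN1r detZ. Qed.

Lemma deriv_char_poly_at0 n (A : 'M[wring E]_n) :
  (char_poly A)^`().[0] = \tr (\adj (- A)).
Proof.
rewrite deriv_char_poly -horner_evalE -trace_map_mx map_mx_adj.
congr (\tr (\adj _)); apply/matrixP => i j.
by rewrite !mxE /= horner_evalE !hornerE hornerMn hornerX mul0rn sub0r.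
Qed.

Lemma char_poly_generator_at0 W :
  (char_poly (principal_mx (fun u v => - laplacian E u v) W)).[0]
  = Psi E (~: W).
Proof.
rewrite char_poly_at0.
have -> : - principal_mx (fun u v => - laplacian E u v) W
    = \matrix_(a, b) laplacian E (enum_val a) (enum_val b).
  by apply/matrixP => a b; rewrite !mxE opprK.
rewrite det_laplacian_forests; last exact: enum_val_inj.
congr (Psi E (~: _)); apply/setP => v; apply/imsetP/idP => [[a _ ->] | vW].
  exact: enum_valP.
by exists (enum_rank_in vW v); rewrite ?enum_rankK_in.
Qed.

Lemma deriv_char_poly_generator_at0 :
  (char_poly (principal_mx (fun u v => - laplacian E u v) [set: V]))^`().[0]
  = \sum_v Psi E [set v].
Proof.
rewrite deriv_char_poly_at0.
have -> : \sum_v Psi E [set v] = \sum_(v in [set: V]) Psi E [set v].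
  by apply: eq_bigl => v; rewrite inE.
rewrite big_enum_val /mxtrace; apply: eq_bigr => a _.
rewrite mxE /cofactor -signr_odd oddD addbb mul1r.
set h := fun b => enum_val (lift a b).
have h_inj : injective h by move=> b c /enum_val_inj/lift_inj.
have -> : row' a (col' a
      (- principal_mx (fun u v => - laplacian E u v) [set: V]))
    = \matrix_(b, c) laplacian E (h b) (h c).
  by apply/matrixP => b c; rewrite !mxE opprK.
rewrite det_laplacian_forests //; congr (Psi E _); apply/setP => v.
rewrite !inE; apply/idP/eqP => [out_v | ->]; last first.
  by apply/imsetP => -[b _ /enum_val_inj/eqP]; rewrite (negPf (neq_lift _ _)).
have vT : v \in [set: V] by [].
have [b v_b | <-] := unliftP a (enum_rank_in vT v); last first.
  by rewrite enum_rankK_in.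
case/negP: out_v; apply/imsetP; exists b; rewrite // /h -v_b.
by rewrite enum_rankK_in.
Qed.

End Assembly.

Theorem corollary3p4 (V : finType) (E : rel V)
    (E_simple : irreflexive E)
    (E_connected : strongly_connected E [set: V])
    (* an arbitrary edge ordering and an arbitrary vertex w \in W, for each W *)
    (ord : {set V} -> seq (V * V)) (base : {set V} -> V)
    (ord_ok : forall W, strongly_connected E W -> edge_ordering E (ord W))
    (base_ok : forall W, strongly_connected E W -> base W \in W)
    (Phi : {fraction wring E}) :
  is_Phi Phi <->
  Phi = (\prod_(W : {set V} | strongly_connected E W && (W \proper [set: V]))
           Psi E (~: W) ^+ mult E (ord W) W (base W))%:F.
Proof.
set M := fun W => mult E (ord W) W (base W).
set Q := \prod_(W | _) _.
have sumM S : strongly_connected E S ->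
    (\sum_(W | strongly_connected E W && (S \subset W)) M W)%N = nb_forests E S.
  exact: sum_mult_family.
pose w (t : sptree E) := weight E (tedges t).
pose tau := \sum_t w t.
have w_ev t : eval1 (w t) = 1 by apply: eval1_weight (sptreeP t).
(* There is a spanning tree, as the trees for which the traversal deletes no
   vertex are as many as the forests rooted at V, that is, one. *)
have [t0 _] : exists t : sptree E, true.
  have /card_gt0P[F] : (0 < #|[set F | spanning_tree_at E (base [set: V]) F
      & [set: V] \subset psi E (ord [set: V]) (base [set: V]) F]|)%N.
    rewrite (traversal_count (ord_ok _ E_connected) E_connected) ?inE //.
    by rewrite -/(nb_forests E _) nb_forestsT.
  by rewrite inE => /andP[treeF _]; exists (Sub (base [set: V], F) treeF).
have tau0 : tau != 0.
  apply/negP => /eqP/(congr1 (@eval1 V E)); rewrite rmorph_sum rmorph0.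
  rewrite (eq_bigr (fun=> 1)) => [|t _]; last exact: w_ev.
  rewrite sumr_const => /eqP; rewrite Num.Theory.pnatr_eq0.
  by move=> /eqP/card0_eq/(_ t0); rewrite inE.
have w0 t : w t != 0.
  by apply/negP => /eqP/(congr1 (@eval1 V E)); rewrite w_ev rmorph0.
(* The derivative at 0 of the factorization: the factor of V vanishes at 0, so
   only its own derivative contributes. *)
have trace_adj : \tr (\adj (tree_laplacian E)) = tau * Q.
  rewrite tree_laplacian_lift // -deriv_char_poly_at0.
  rewrite (char_poly_lift (@pchar_wring V E) (@generator_supp V E) sumM).
  rewrite (bigD1 [set: V]) //=.
  have -> : M [set: V] = 1%N.
    rewrite -(nb_forestsT E) -sumM // (big_pred1 [set: V]) // => W.
    by rewrite subTset /=; case: eqP => [->|_]; rewrite ?E_connected ?andbF.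
  rewrite expr1 derivM !hornerE char_poly_generator_at0 setCT.
  rewrite (Psi_set0 _ (base set0)) mul0r addr0 deriv_char_poly_generator_at0.
  rewrite -sum_tree_weights; congr (_ * _).
  rewrite horner_prod; apply: eq_big => [W | W _]; first by rewrite properT.
  by rewrite horner_exp char_poly_generator_at0.
have minorE t : \det (reduced_tree_laplacian t) = w t * Q.
  have := null_vectors_cofactor (enum_rank t) (@pchar_wring V E)
    (tree_laplacian_null E_simple) (tree_laplacian_row E_simple).
  rewrite trace_adj mxE enum_rankK.
  have -> : \sum_r tree_weights E 0 r = tau.
    by rewrite /tau (big_enum_val w); apply: eq_bigr => a _; rewrite mxE.
  rewrite mulrCA => /(mulfI tau0) ->.
  by rewrite /cofactor -signr_odd oddD addbb mul1r.
have is_PhiQ : is_Phi Q%:F by move=> t; rewrite minorE rmorphM.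
split=> [PhiP | -> //].
have w_frac : (w t0)%:F != 0 by rewrite tofrac_eq0.
by apply: (mulfI w_frac); rewrite -PhiP -is_PhiQ.
Qed.
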